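(* Let $I=\{1,\dots,n\}$, let $S$ be the set of non-empty subsets of $I$, and let $a_s\ge0$, $s\in S$. Let $\mathcal{E}(\beta)$ be the almost sure limiting free energy of the Gaussian Bolthausen–Kistler generalized random energy model with weights $(a_s)_{s\in S}$, and for each permutation $\pi$ of $I$ let $\mathcal{E}(\pi,\beta)$ be the almost sure limiting free energy of the associated Gaussian $n$-level generalized random energy model with weights $w(\pi,1),\dots,w(\pi,n)$ (both described in the context). Then, for $\beta>0$, almost surely $$\mathcal{E}(\beta)=\inf_{\pi}\mathcal{E}(\pi,\beta),$$ the infimum being over all $n!$ permutations $\pi$ of $I$.
   Context: For each $N\ge n$ let $k(1,N),\dots,k(n,N)\ge1$ be integers with sum $N$ and $\frac{k(i,N)}N\to p_i>0$ as $N\to\infty$. Write $\sigma\in\{+1,-1\}^N$ as $\sigma_1\cdots\sigma_n$ with $\sigma_i\in\{+1,-1\}^{k(i,N)}$. Bolthausen–Kistler model: for $s=\{i_1<\cdots<i_k\}\in S$ let $\sigma(s)=\sigma_{i_1}\cdots\sigma_{i_k}$. For each $N$ let $\xi(s,\sigma(s))$, one for each $s\in S$ and each value of $\sigma(s)$, be i.i.d. $\mathcal{N}(0,\frac1N)$. $H_N(\sigma)=N\sum_{s\in S}a_s\xi(s,\sigma(s))$, and $\mathcal{E}(\beta)=\lim_N\frac1N\log\sum_\sigma e^{-\beta H_N(\sigma)}$ (the almost sure limit, a nonrandom quantity). Associated tree model for a permutation $\pi$ of $I$: there are $2^{k(\pi(i),N)}$ nodes at level $i$ below each node of level $i-1$,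 $1\le i\le n$; equivalently, level-$i$ nodes are $\sigma_{\pi(1)}\cdots\sigma_{\pi(i)}$. The weight at level $i$ is $w(\pi,i)\ge0$ with $$w^2(\pi,i)=\sum_{s\in S:\ s\subseteq\{\pi(1),\dots,\pi(i)\},\ s\nsubseteq\{\pi(1),\dots,\pi(i-1)\}}a_s^2.$$ For each $N$ let $\eta(\sigma_{\pi(1)}\cdots\sigma_{\pi(i)})$ be i.i.d. $\mathcal{N}(0,\frac1N)$ over all nodes, $H_N^\pi(\sigma)=N\sum_{i=1}^nw(\pi,i)\,\eta(\sigma_{\pi(1)}\cdots\sigma_{\pi(i)})$, and $\mathcal{E}(\pi,\beta)=\lim_N\frac1N\log\sum_\sigma e^{-\beta H^\pi_N(\sigma)}$ (the almost sure limit, a nonrandom quantity). *)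

(* Defs.v *)
From HB Require Import structures.
From mathcomp Require Import all_boot all_order all_algebra all_fingroup.
From mathcomp Require Import all_classical all_reals all_analysis.

Set Implicit Arguments.
Unset Strict Implicit.
Unset Printing Implicit Defensive.

Import Order.TTheory GRing.Theory Num.Theory.
Import numFieldNormedType.Exports.

Local Open Scope classical_set_scope.
Local Open Scope ring_scope.

(* Mutual independence: the product rule for every finite subfamily. *)
Definition mutually_independent (R : realType) (d : measure_display)
    (T : measurableType d) (P : probability T R) (K : finType)
    (X : K -> {RV P >-> R}) : Prop :=
  forall (J : {set K}) (A : K -> set R), (forall j, measurable (A j)) ->
    P (\big[setI/setT]_(j in J) (X j @^-1` A j)) =
    (\prod_(j in J) P (X j @^-1` A j))%E.

(* The parameter of [normal_prob] is the standard deviation; measures are only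
   meaningful on measurable sets, whence the restriction on [A]. *)
Definition is_normal (R : realType) (d : measure_display)
    (T : measurableType d) (P : probability T R)
    (m v : R) (X : {RV P >-> R}) : Prop :=
  forall A : set R, measurable A ->
    distribution P X A = normal_prob m (Num.sqrt v) A.

Definition iid_normal (R : realType) (d : measure_display)
    (T : measurableType d) (P : probability T R) (K : finType)
    (m v : R) (X : K -> {RV P >-> R}) : Prop :=
  mutually_independent X /\ forall j, is_normal m v (X j).

Definition almost_sure_limit (R : realType) (d : measure_display)
    (T : measurableType d) (P : probability T R)
    (u : nat -> T -> R) (l : R) : Prop :=
  {ae P, forall w, u N w @[N --> \oo] --> l}.

(* Spins only serve as labels of the random variables, so {+1, -1} is encoded
   by [bool].  For block lengths b, a configuration is the family of its blocks
   sigma_i in {+1, -1}^(b i). *)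
Definition config (n : nat) (b : 'I_n -> nat) : finType :=
  {dffun forall i : 'I_n, {ffun 'I_(b i) -> bool}}.

(* Values of sigma(s), the concatenation of the blocks with index in s. *)
Definition subconfig (n : nat) (b : 'I_n -> nat) (s : {set 'I_n}) : finType :=
  {dffun forall i : {i : 'I_n | i \in s}, {ffun 'I_(b (val i)) -> bool}}.

Definition restrict (n : nat) (b : 'I_n -> nat) (sigma : config b)
    (s : {set 'I_n}) : subconfig b s :=
  [ffun i : {i : 'I_n | i \in s} => sigma (val i)].

Definition nonempty_sets (n : nat) : finType :=
  {s : {set 'I_n} | s != finset.set0}.

Definition bk_index (n : nat) (b : 'I_n -> nat) : finType :=
  {s : nonempty_sets n & subconfig b (val s)}.

(* {pi(1), ..., pi(i)}; positions are counted from 0 in 'I_n. *)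
Definition prefix_set (n : nat) (pi : {perm 'I_n}) (i : nat) : {set 'I_n} :=
  [set pi j | j : 'I_n & (j < i)%N]%SET.

(* Nodes of the tree: level i (from 0) consists of the values of
   sigma_pi(0) ... sigma_pi(i). *)
Definition tree_node (n : nat) (b : 'I_n -> nat) (pi : {perm 'I_n}) : finType :=
  {i : 'I_n & subconfig b (prefix_set pi i.+1)}.

Definition tree_weight (R : realType) (n : nat) (a : nonempty_sets n -> R)
    (pi : {perm 'I_n}) (i : 'I_n) : R :=
  Num.sqrt (\sum_(s : nonempty_sets n |
               (val s \subset prefix_set pi i.+1) &&
               ~~ (val s \subset prefix_set pi i)) a s ^+ 2).

(* The two Hamiltonians, for one realisation of the disorder. *)
Definition bk_hamiltonian (R : realType) (n : nat) (b : 'I_n -> nat) (N : nat)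
    (a : nonempty_sets n -> R) (xi : bk_index b -> R) (sigma : config b) : R :=
  N%:R * \sum_(s : nonempty_sets n)
    a s * xi (Tagged (fun s : nonempty_sets n => subconfig b (val s))
                (restrict sigma (val s))).

Definition tree_hamiltonian (R : realType) (n : nat) (b : 'I_n -> nat)
    (N : nat) (a : nonempty_sets n -> R) (pi : {perm 'I_n})
    (eta : tree_node b pi -> R) (sigma : config b) : R :=
  N%:R * \sum_(i < n)
    tree_weight a pi i *
    eta (Tagged (fun i : 'I_n => subconfig b (prefix_set pi i.+1))
           (restrict sigma (prefix_set pi i.+1))).

Definition free_energy (R : realType) (n : nat) (b : 'I_n -> nat) (N : nat)
    (beta : R) (H : config b -> R) : R :=
  N%:R^-1 * ln (\sum_(sigma : config b) expR (- beta * H sigma)).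

(* Main.v *)
Require Import Defs.
From HB Require Import structures.
From mathcomp Require Import all_boot all_order all_algebra all_fingroup.
From mathcomp Require Import all_classical all_reals all_analysis.
From mathcomp Require Import measurable_realfun ring lra.

Set Implicit Arguments.
Unset Strict Implicit.
Unset Printing Implicit Defensive.

Import Order.TTheory GRing.Theory Num.Theory.
Import numFieldNormedType.Exports.

Import HBNNSimple.

Local Open Scope classical_set_scope.
Local Open Scope ring_scope.

(** Both Hamiltonians are instances of one model.  There are finitely many
    levels l, each with a set S l of blocks and a weight c l >= 0, and one
    Gaussian variable for every level and every value of the blocks in S l.
    The levels of the Bolthausen-Kistler model are the nonempty sets of blocks;
    those of the tree of a permutation pi are the prefixes of pi.  The limiting
    free energy of the general model is squeezed between two explicit rates
    ([model_free_energy]).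

    Upper rate.  Attach to every block i an exponent M i in ]0, 1] and to a set
    of blocks the largest exponent that it contains.  The partition function Z
    has a moment of small fractional order that can be bounded by peeling off
    the blocks in increasing order of M: since M i <= 1, the power M i of a sum
    is at most the sum of the powers, and Jensen's inequality passes from one
    exponent to the next larger one ([partition_moment]).  Markov's inequality
    and the Borel-Cantelli lemma then bound the free energy almost surely by
      sum_i p_i ln 2 / M_i + sum_l max_(S l) M * beta^2 c_l^2 / 2.

    Lower rate.  Ask every level l to contribute an energy of depth N x_l.  The
    expected number of such configurations, when only the blocks in A are seen,
    has exponential rate sum_(i in A) p_i ln 2 - sum_(S l in A) x_l^2 / 2.  If
    this is positive for every nonempty A, the second moment is comparable to
    the square of the first and the number of configurations concentrates
    ([deep_count_concentration]), whence the almost sure lower bound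
      sum_i p_i ln 2 - sum_l x_l^2 / 2 + beta sum_l c_l x_l.

    Duality.  The two rates meet ([rate_duality]).  As beta grows, sets of
    blocks freeze one after the other; greedily removing the set that freezes
    first yields a chain of sets with increasing critical exponents M, and
    x_l = max_(S l) M * beta c_l exhausts the entropy of every frozen layer.

    Comparison.  A profile x allowed for the Bolthausen-Kistler model is turned
    into a profile of the tree of any pi by taking the Euclidean norm of x over
    each tree level; this respects the entropy constraints and, by the
    Cauchy-Schwarz inequality, cannot lower the lower rate ([lower_rate_tree]).
    Hence the Bolthausen-Kistler free energy is at most that of every tree.
    Conversely, if pi sorts the blocks by the optimal exponents M, all the sets
    that enter at a given tree level have the same largest exponent, so the
    upper rates at M of the two models agree ([upper_rate_tree]), and this tree
    attains the bound. *)

(** * Integrals against a density, independence and Laplace transforms *)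

(** Common to the change of variables for a law and for a density: the
    hypothesis is the claim for indicators, and simple functions increasing to
    [g] do the rest. *)
Lemma ge0_integral_density (R : realType) (d1 d2 : measure_display)
    (T : measurableType d1) (U : measurableType d2)
    (m : {measure set T -> \bar R}) (nu : {measure set U -> \bar R})
    (X : T -> U) (Y : T -> R) (g : U -> R) :
  measurable_fun setT X ->
  measurable_fun setT Y -> (forall w, 0 <= Y w) ->
  (forall A : set U, measurable A ->
     \int[m]_(w in X @^-1` A) (Y w)%:E = nu A)%E ->
  measurable_fun setT g -> (forall x, 0 <= g x) ->
  (\int[m]_w (g (X w) * Y w)%:E = \int[nu]_x (g x)%:E)%E.
Proof.
move=> mX mY Y0 hA mg g0.
have mgE : measurable_fun setT (fun x => (g x)%:E) by exact/measurable_EFinP.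
pose f := nnsfun_approx measurableT mgE.
have fcvg x : (f n x)%:E @[n --> \oo] --> (g x)%:E.
  by apply: (cvg_nnsfun_approx measurableT mgE) => // y _ /=; rewrite lee_fin.
have fnd x : nondecreasing_seq (fun n => f n x).
  by move=> k n kn; have /lefP := nd_nnsfun_approx measurableT mgE kn; exact.
have f0 n x : 0 <= f n x by exact: fun_ge0.
have mf n : measurable_fun setT (fun w => f n (X w)).
  by apply: measurableT_comp => //.
have step n : (\int[m]_w (f n (X w) * Y w)%:E = \int[nu]_x (f n x)%:E)%E.
  set s := finmap.enum_fset (fset_set (f n @` setT)).
  have fE x := fimfunEord (f n) x; rewrite -/s /= in fE.
  have s0 (i : 'I_(size s)) : 0 <= s`_i.
    have : s`_i \in s by rewrite mem_nth.
    rewrite /s in_fset_set; last exact: fimfunP.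
    by rewrite inE => -[x _ <-].
  have mA (i : 'I_(size s)) : measurable (f n @^-1` [set s`_i]).
    exact: measurable_sfunP.
  have mXA (i : 'I_(size s)) : measurable (X @^-1` (f n @^-1` [set s`_i])).
    by rewrite -[_ @^-1` _]setTI; exact: mX.
  transitivity (\sum_(i < size s) (s`_i)%:E * nu (f n @^-1` [set s`_i]))%E.
    under eq_integral do rewrite fE mulr_suml -sumEFin.
    rewrite ge0_integral_sum//.
    - apply: eq_bigr => i _.
      under eq_integral do rewrite -mulrA EFinM.
      rewrite ge0_integralZl_EFin//.
      + rewrite -hA// [in RHS]integral_mkcond; congr (_ * _)%E.
        apply: eq_integral => w _; rewrite patchE indicE.
        case: ifPn => [/set_mem|/negP] /= H; first by rewrite mem_set// mul1r.
        by rewrite memNset ?mul0r// => /(@mem_set _ (X @^-1` (f n @^-1` [set s`_i]))).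
      + by move=> w _; rewrite lee_fin mulr_ge0.
      + apply/measurable_EFinP/measurable_funM => //.
        by apply: measurableT_comp => //; exact: measurable_indic.
    - move=> i; apply/measurable_EFinP/measurable_funM => //.
      apply: measurable_funM => //.
      by apply: measurableT_comp => //; exact: measurable_indic.
    - by move=> i w _; rewrite lee_fin !mulr_ge0.
  under [RHS]eq_integral do rewrite fE -sumEFin.
  rewrite ge0_integral_sum//.
  - apply: eq_bigr => i _.
    under eq_integral do rewrite EFinM.
    rewrite ge0_integralZl_EFin//; first by rewrite integral_indic// setIT.
    by apply/measurable_EFinP; exact: measurable_indic.
  - by move=> i; exact/measurable_EFinP/measurable_funM.
  - by move=> i w _; rewrite lee_fin mulr_ge0.
have c1 : (\int[m]_w (f n (X w) * Y w)%:E @[n --> \oo] -->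
    \int[m]_w (g (X w) * Y w)%:E)%E.
  have -> : (\int[m]_w (g (X w) * Y w)%:E =
    \int[m]_w (limn (fun n => (f n (X w) * Y w)%:E)))%E.
    apply: eq_integral => w _; apply/esym/cvg_lim => //.
    under eq_fun do rewrite EFinM.
    by rewrite EFinM; apply: cvgeZr => //; exact: fcvg.
  apply: cvg_monotone_convergence => //.
  - by move=> n; apply/measurable_EFinP/measurable_funM.
  - by move=> n w _; rewrite lee_fin mulr_ge0.
  - by move=> w _ k n kn; rewrite lee_fin ler_wpM2r// fnd.
have c2 : (\int[nu]_x (f n x)%:E @[n --> \oo] --> \int[nu]_x (g x)%:E)%E.
  have -> : (\int[nu]_x (g x)%:E =
    \int[nu]_x (limn (fun n => (f n x)%:E)))%E.
    by apply: eq_integral => w _; apply/esym/cvg_lim => //; exact: fcvg.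
  apply: cvg_monotone_convergence => //.
  - by move=> n; exact/measurable_EFinP.
  - by move=> n w _; rewrite lee_fin.
  - by move=> w _ k n kn; rewrite lee_fin fnd.
by apply: (cvg_unique _ c1) => //; rewrite (funext step).
Qed.

(** Independence of [X] and [Y] is only assumed through the events of [X], so
    that [Y] may be a partial product in an induction over a family. *)
Lemma ge0_integral_comp_mul (R : realType) (d : measure_display)
    (T : measurableType d) (P : probability T R) (X : {RV P >-> R})
    (Y : T -> R) (g : R -> R) :
  measurable_fun setT Y -> (forall w, 0 <= Y w) ->
  (\int[P]_w (Y w)%:E \is a fin_num)%E ->
  (forall A : set R, measurable A ->
     \int[P]_(w in X @^-1` A) (Y w)%:E
       = P (X @^-1` A) * \int[P]_w (Y w)%:E)%E ->
  measurable_fun [set: R] g -> (forall x, 0 <= g x) ->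
  (\int[P]_w (g (X w) * Y w)%:E
     = \int[P]_w (g (X w))%:E * \int[P]_w (Y w)%:E)%E.
Proof.
move=> mY Y0 finY hA mg g0.
have EY0 : 0 <= fine (\int[P]_w (Y w)%:E).
  by apply/fine_ge0/integral_ge0 => w _; rewrite lee_fin.
rewrite (@ge0_integral_density _ _ _ _ _ P
  (mscale (NngNum EY0) (distribution P X)) X Y g)//.
  rewrite ge0_integral_mscale//=.
  - rewrite ge0_integral_distribution//=; first by rewrite fineK// muleC.
    exact/measurable_EFinP.
  - exact/measurable_EFinP.
  - by move=> x _; rewrite lee_fin.
by move=> A mA; rewrite hA// -[X in (_ * X)%E = _](fineK finY) muleC.
Qed.

(** Completing the square turns the tilted density into the density centred at
    [v * t]. *)
Lemma integral_expR_normal (R : realType) (d : measure_display)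
    (T : measurableType d) (P : probability T R) (X : {RV P >-> R}) (v t : R) :
  0 < v -> is_normal 0 v X ->
  (\int[P]_w (expR (t * X w))%:E = (expR (v * t ^+ 2 / 2))%:E)%E.
Proof.
move=> v0 hX; have s0 : Num.sqrt v != 0 by rewrite gt_eqF// sqrtr_gt0.
have s2 : Num.sqrt v ^+ 2 = v by rewrite sqr_sqrtr// ltW.
have mE : measurable_fun [set: R] (fun x : R => expR (t * x)).
  by apply: measurableT_comp => //; exact: measurable_funM.
have -> : (\int[P]_w (expR (t * X w))%:E
    = \int[distribution P X]_x (expR (t * x))%:E)%E.
  rewrite ge0_integral_distribution//; exact/measurable_EFinP.
rewrite -(@ge0_integral_density _ _ _ _ _ (@lebesgue_measure R)
  (distribution P X) idfun (normal_pdf 0 (Num.sqrt v)) (fun x => expR (t * x)))//.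
- transitivity (\int[@lebesgue_measure R]_x
     ((expR (v * t ^+ 2 / 2))%:E * (normal_pdf (v * t) (Num.sqrt v) x)%:E))%E.
    apply: eq_integral => x _; rewrite -EFinM; congr EFin.
    rewrite !normal_pdfE// mulrCA [RHS]mulrCA; congr (_ * _).
    rewrite /normal_fun -!expRD s2; congr expR.
    by rewrite /= subr0; field; exact: lt0r_neq0.
  rewrite ge0_integralZl_EFin//.
  + by rewrite integral_normal_pdf mule1.
  + by move=> x _; rewrite lee_fin normal_pdf_ge0.
  + by apply/measurable_EFinP; exact: measurable_normal_pdf.
- exact: measurable_id.
- exact: measurable_normal_pdf.
- by move=> x; exact: normal_pdf_ge0.
- by move=> A mA; apply/esym; exact: (hX A mA).
Qed.

(** Independence is a statement about events; it is lifted to functions one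
    variable at a time, keeping events for the variables still to be treated. *)
Lemma integral_prod_indep (R : realType) (d : measure_display)
    (T : measurableType d) (P : probability T R) (K : finType)
    (X : K -> {RV P >-> R}) (g : K -> R -> R) :
  mutually_independent X ->
  (forall j, measurable_fun [set: R] (g j)) -> (forall j x, 0 <= g j x) ->
  (forall j, (\int[P]_w (g j (X j w))%:E)%E \is a fin_num) ->
  (\int[P]_w (\prod_j g j (X j w))%:E = \prod_j \int[P]_w (g j (X j w))%:E)%E.
Proof.
move=> indX mg g0 gfin.
have mX j A : measurable A -> measurable (X j @^-1` A).
  by move=> mA; rewrite -[_ @^-1` _]setTI; exact: measurable_funP.
have mgX j : measurable_fun setT (fun w => g j (X j w)) by exact: measurableT_comp.
suff key (s : seq K) (J : {set K}) (A : K -> set R) :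
    uniq s -> {in s, forall j, j \notin J} -> (forall j, measurable (A j)) ->
    (\int[P]_(w in \big[setI/setT]_(j in J) (X j @^-1` A j))
       (\prod_(j <- s) g j (X j w))%:E
     = (\prod_(j <- s) \int[P]_w (g j (X j w))%:E) *
       \prod_(j in J) P (X j @^-1` A j))%E.
  have := key (index_enum K) finset.set0 (fun=> setT) (index_enum_uniq K).
  by rewrite !big_set0 mule1 => -> // j _; rewrite finset.in_set0.
elim: s J A => [|i s IH] J A.
  move=> _ _ mA; rewrite big_nil mul1e -indX//.
  under eq_integral do rewrite big_nil.
  rewrite integral_cst ?mul1e//.
  by apply: big_ind => //; [exact: measurableI|move=> j _; exact: mX].
move=> /= /andP[iNs us] sJ mA.
set D := \big[setI/setT]_(j in J) _.
have mD : measurable D.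
  by apply: big_ind => //; [exact: measurableI|move=> j _; exact: mX].
pose Y w := \1_D w * \prod_(j <- s) g j (X j w).
have mp : measurable_fun setT (fun w => \prod_(j <- s) g j (X j w)).
  by apply: measurable_prod => j _; exact: mgX.
have mY : measurable_fun setT Y.
  by apply: measurable_funM => //; exact: measurable_indic.
have Y0 w : 0 <= Y w by rewrite /Y mulr_ge0// prodr_ge0.
have restr (B : set T) (h : T -> R) :
    (\int[P]_(w in B) (h w)%:E = \int[P]_w (\1_B w * h w)%:E)%E.
  rewrite integral_mkcond; apply: eq_integral => w _; rewrite patchE indicE.
  by case: ifPn => _; rewrite ?mul1r ?mul0r.
have EY : (\int[P]_w (Y w)%:E = (\prod_(j <- s) \int[P]_w (g j (X j w))%:E) *
       \prod_(j in J) P (X j @^-1` A j))%E.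
  by rewrite -restr IH// => j js; apply: sJ; rewrite inE js orbT.
rewrite restr.
transitivity (\int[P]_w (g i (X i w) * Y w)%:E)%E.
  apply: eq_integral => w _; congr EFin.
  by rewrite big_cons /Y mulrCA.
rewrite (ge0_integral_comp_mul mY Y0)//; first by rewrite EY muleA big_cons.
- rewrite EY fin_numM//; apply: prode_fin_num => j _; first exact: gfin.
  by apply: fin_num_measure; exact: mX.
- move=> B mB.
  have iJ : i \notin J by apply: sJ; rewrite inE eqxx.
  rewrite restr EY.
  pose A' j := if j == i then B else A j.
  have -> : (\int[P]_w (\1_(X i @^-1` B) w * Y w)%:E =
      \int[P]_(w in \big[setI/setT]_(j in i |: J) (X j @^-1` A' j))
         (\prod_(j <- s) g j (X j w))%:E)%E.
    rewrite [RHS]restr; apply: eq_integral => w _; congr EFin.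
    rewrite big_setU1//= {1}/A' eqxx.
    have -> : \big[setI/setT]_(j in J) (X j @^-1` A' j) = D.
      apply: eq_bigr => j jJ; rewrite /A'; case: eqP => // ji.
      by move: iJ; rewrite -ji jJ.
    by rewrite indicI /Y mulrA.
  rewrite IH//.
  + rewrite big_setU1//= {1}/A' eqxx muleCA; congr (_ * (_ * _))%E.
    apply: eq_bigr => j jJ; rewrite /A'; case: eqP => // ji.
    by move: iJ; rewrite -ji jJ.
  + move=> j js; rewrite in_setU1 negb_or sJ ?inE ?js ?orbT// andbT.
    by apply: contraNneq iNs => <-.
  + by move=> j; rewrite /A'; case: ifP.
Qed.

(** The only fact about independent Gaussians that the upper bound uses. *)
Lemma integral_expR_iid_normal (R : realType) (d : measure_display)
    (T : measurableType d) (P : probability T R) (K : finType)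
    (X : K -> {RV P >-> R}) (v : R) (t : K -> R) :
  0 < v -> iid_normal 0 v X ->
  (\int[P]_w (expR (\sum_j t j * X j w))%:E
     = (expR (\sum_j v * t j ^+ 2 / 2))%:E)%E.
Proof.
move=> v0 [indX nX].
have E j := integral_expR_normal (t j) v0 (nX j).
under eq_integral do rewrite expR_sum.
rewrite (@integral_prod_indep _ _ _ _ _ X (fun j x => expR (t j * x)))//.
- by rewrite expR_sum -prodEFin; apply: eq_bigr => j _; rewrite E.
- move=> j; apply: measurableT_comp => //; exact: measurable_funM.
- by move=> j; rewrite E.
Qed.

(** * Gaussian tails and the Borel-Cantelli lemma *)

(** On the interval from [- z] to [- y] the density is smallest at [- z]. *)
Lemma normal_lower_tail (R : realType) (d : measure_display)
    (T : measurableType d) (P : probability T R) (X : {RV P >-> R})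
    (v y z : R) :
  0 < v -> is_normal 0 v X -> 0 <= y -> y < z ->
  (((z - y) * (normal_peak (Num.sqrt v) * expR (- z ^+ 2 / (v *+ 2))))%:E
     <= P (X @^-1` `]-oo, (- y)%R]))%E.
Proof.
move=> v0 hX y0 yz; have s0 : Num.sqrt v != 0 by rewrite gt_eqF// sqrtr_gt0.
have s2 : Num.sqrt v ^+ 2 = v by rewrite sqr_sqrtr// ltW.
rewrite [leRHS](hX `]-oo, (- y)%R]%classic)//.
apply: (@le_trans _ _ (normal_prob 0 (Num.sqrt v) `[(- z)%R, (- y)%R]%classic)).
  rewrite /normal_prob.
  have -> : (((z - y) * (normal_peak (Num.sqrt v) * expR (- z ^+ 2 / (v *+ 2))))%:E
    = \int[@lebesgue_measure R]_(x in `[(- z)%R, (- y)%R])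
        (cst (normal_peak (Num.sqrt v) * expR (- z ^+ 2 / (v *+ 2)))%:E x))%E.
    rewrite integral_cst//= lebesgue_measure_itv/= lte_fin ltrN2 yz.
    by rewrite -EFinD -EFinM opprK mulrC (addrC (- y)).
  apply: ge0_le_integral => //=.
  - by move=> x _; rewrite lee_fin mulr_ge0 ?normal_peak_ge0 ?expR_ge0.
  - apply/measurable_EFinP; apply: measurable_funTS.
    exact: measurable_normal_pdf.
  - move=> x; rewrite /= in_itv/= => /andP[zx xy].
    rewrite lee_fin normal_pdfE// ler_wpM2l ?normal_peak_ge0//.
    rewrite /normal_fun s2 subr0 ler_expR ler_wpM2r//.
      by rewrite invr_ge0 mulrn_wge0// ltW.
    rewrite lerN2; have : 0 <= (z + x) * (z - x) by apply: mulr_ge0; lra.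
    lra.
apply: le_measure; rewrite ?inE//.
by move=> x /=; rewrite !in_itv/= => /andP[].
Qed.

(** With variance 1/N the factor [(z - y) * normal_peak] grows like the square
    root of N, so it exceeds 1 once N >= 2 pi / (z - y)^2. *)
Lemma normal_lower_tail_rate (R : realType) (y z : R) :
  0 <= y -> y < z ->
  exists N0 : nat, forall N, (N0 <= N)%N ->
    forall (d : measure_display) (T : measurableType d) (P : probability T R)
      (X : {RV P >-> R}), is_normal 0 N%:R^-1 X ->
    ((expR (- (N%:R * (z ^+ 2 / 2))))%:E <= P (X @^-1` `]-oo, (- y)%R]))%E.
Proof.
move=> y0 yz; have zy0 : 0 < z - y by rewrite subr_gt0.
exists (Num.truncn (pi *+ 2 / (z - y) ^+ 2)).+1 => N hN d T P X hX.
have N0 : 0 < N%:R :> R by rewrite ltr0n (leq_trans _ hN).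
have v0 : 0 < N%:R^-1 :> R by rewrite invr_gt0.
apply: le_trans (normal_lower_tail v0 hX y0 yz); rewrite lee_fin.
have -> : expR (- z ^+ 2 / (N%:R^-1 *+ 2)) = expR (- (N%:R * (z ^+ 2 / 2))).
  by congr expR; field; exact: lt0r_neq0.
rewrite [leRHS]mulrA ler_peMl ?expR_ge0//.
rewrite /normal_peak sqr_sqrtr ?(ltW v0)// ler_pdivlMr; last first.
  by rewrite sqrtr_gt0 mulrn_wgt0// mulr_gt0// pi_gt0.
rewrite mul1r -(ger0_norm (ltW zy0)) -sqrtr_sqr ler_wsqrtr//.
rewrite -mulrnAr mulrC ler_pdivrMr//.
rewrite mulrC -ler_pdivrMr ?exprn_gt0//.
apply: (le_trans (ltW (truncnS_gt _))).
by rewrite ler_nat.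
Qed.

Lemma ae_eventually_not (R : realType) (d : measure_display)
    (T : measurableType d) (P : probability T R) (F : nat -> set T)
    (C g : R) (N0 : nat) :
  (forall N, measurable (F N)) -> 0 < g ->
  (forall N, (N0 <= N)%N -> (P (F N) <= (C * expR (- (g * N%:R)))%:E)%E) ->
  {ae P, forall w, \forall N \near \oo, ~ F N w}.
Proof.
move=> mF g0 hF; pose G N := F (N + N0)%N.
have C0 : 0 <= C.
  have := le_trans (measure_ge0 P (F N0)) (hF N0 (leqnn _)).
  by rewrite lee_fin pmulr_lge0 ?expR_gt0.
have hG N : (P (G N) <= (geometric C (expR (- g)) N)%:E)%E.
  apply: (le_trans (hF _ (leq_addl _ _))).
  rewrite lee_fin ler_wpM2l// -expRM_natr ler_expR mulNr lerN2 ler_pM2l//.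
  by rewrite ler_nat leq_addr.
have cvgG : cvgn (series (geometric C (expR (- g)))).
  apply: is_cvg_geometric_series.
  by rewrite ger0_norm ?expR_ge0// expR_lt1 oppr_lt0.
have : P (lim_sup_set G) = 0%E.
  apply: lim_sup_set_cvg0 => [N|]; first exact: mF.
  apply: (@le_lt_trans _ _ (\sum_(n <oo) (geometric C (expR (- g)) n)%:E)%E).
    apply: lee_nneseries => // n _; exact: hG.
  rewrite (_ : (\sum_(n <oo) _)%E = (limn (series (geometric C (expR (- g)))))%:E) ?ltry//.
  rewrite -EFin_lim//; congr (limn _); apply/funext => n /=.
  by rewrite -sumEFin.
move=> P0; exists (lim_sup_set G); split => //.
  apply: bigcap_measurable => [|n _]; first by exists 0%N.
  by apply: bigcup_measurable => k _; exact: mF.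
move=> w /= nw n _ /=; apply: contrapT => H; apply: nw.
exists (n + N0)%N => // N /= hN FN; apply: H.
exists (N - N0)%N => /=; first by rewrite leq_subRL ?(leq_trans (leq_addl _ _) hN)// addnC.
by rewrite /G subnK// (leq_trans (leq_addl _ _) hN).
Qed.

(** * Greedy construction of the frozen layers *)

(** The default 0 of the maximum is harmless: exponents are positive and are
    only compared on nonempty sets. *)
Definition wmax (R : realType) (n : nat) (M : 'I_n -> R) (A : {set 'I_n}) : R :=
  \big[Num.max/0]_(i in A) M i.

Lemma wmax_ge (R : realType) (n : nat) (M : 'I_n -> R) (A : {set 'I_n}) i :
  i \in A -> M i <= wmax M A.
Proof. by move=> iA; exact: (le_bigmax_cond 0). Qed.

Lemma wmax_le (R : realType) (n : nat) (M : 'I_n -> R) (A : {set 'I_n}) x :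
  0 <= x -> (forall i, i \in A -> M i <= x) -> wmax M A <= x.
Proof. by move=> x0 h; exact: bigmax_le. Qed.

Lemma wmax_ge0 (R : realType) (n : nat) (M : 'I_n -> R) (A : {set 'I_n}) :
  0 <= wmax M A.
Proof. exact: bigmax_ge_id. Qed.

Lemma wmax_eq (R : realType) (n : nat) (M : 'I_n -> R) (A : {set 'I_n}) i :
  0 <= M i -> i \in A -> (forall j, j \in A -> M j <= M i) -> wmax M A = M i.
Proof. by move=> M0 iA h; apply/eqP; rewrite eq_le wmax_le//= wmax_ge. Qed.

(** Think of [f i] as the entropy of block i and of [C l] as the square of the
    energy scale of level l.  The blocks of [B] are already frozen, with
    exponents at most [m0].  Among the sets A containing [B], the one with the
    smallest ratio of remaining entropy to remaining squared energy freezes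
    next, at the exponent [m] whose square is that ratio.  Minimality of the
    ratio makes [m] an admissible exponent for every larger set, and subtracting
    the equality for the minimiser keeps the hypothesis true after that set has
    been frozen.  When all ratios are at least 1, the remaining blocks stay
    unfrozen and get exponent 1.  Of the conclusions, the second says that the
    entropy constraints hold, and the third, that they are saturated on every
    layer whose exponent is not 1 (complementary slackness). *)
Lemma greedy_duality (R : realType) (n : nat) (L : finType)
    (S : L -> {set 'I_n}) (f : 'I_n -> R) (C : L -> R) :
  (forall i, 0 < f i) -> (forall l, 0 <= C l) ->
  forall (B : {set 'I_n}) (m0 : R), 0 <= m0 -> m0 <= 1 ->
  (forall A : {set 'I_n}, B \subset A ->
     m0 ^+ 2 * \sum_(l | (S l \subset A) && ~~ (S l \subset B)) C l
       <= \sum_(i in A :\: B) f i) ->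
  exists M : 'I_n -> R,
    [/\ forall i, i \notin B -> [/\ m0 <= M i, 0 < M i & M i <= 1],
        forall A : {set 'I_n}, B \subset A ->
          \sum_(l | (S l \subset A) && ~~ (S l \subset B))
             wmax M (S l :\: B) ^+ 2 * C l <= \sum_(i in A :\: B) f i
      & \sum_(i in ~: B) f i * ((M i)^-1 - 1)
          = \sum_(l | ~~ (S l \subset B))
              C l * wmax M (S l :\: B) * (1 - wmax M (S l :\: B))].
Proof.
move=> f0 C0 B; have [k] := ubnP #|~: B|; elim: k B => // k IH B hk m0 m00 m01 hB.
pose h (B A : {set 'I_n}) := \sum_(l | (S l \subset A) && ~~ (S l \subset B)) C l.
pose F (B A : {set 'I_n}) := \sum_(i in A :\: B) f i.
have split_L (g : L -> R) (A A' : {set 'I_n}) : B \subset A' ->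
    \sum_(l | (S l \subset A) && ~~ (S l \subset B)) g l =
    \sum_(l | (S l \subset A :&: A') && ~~ (S l \subset B)) g l +
    \sum_(l | (S l \subset A) && ~~ (S l \subset A')) g l.
  move=> BA'; rewrite (bigID (fun l => S l \subset A'))/=; congr (_ + _).
    by apply: eq_bigl => l; rewrite finset.subsetI -!andbA; congr andb; rewrite andbC.
  apply: eq_bigl => l; rewrite -andbA; congr andb.
  case SA': (S l \subset A'); first by rewrite andbF.
  by rewrite andbT; apply/negP => SB; rewrite (fintype.subset_trans SB) in SA'.
have split_I (g : 'I_n -> R) (A A' : {set 'I_n}) : B \subset A' ->
    \sum_(i in A :\: B) g i =
    \sum_(i in (A :&: A') :\: B) g i + \sum_(i in A :\: A') g i.
  move=> BA'; rewrite (bigID (fun i => i \in A'))/=; congr (_ + _).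
    by apply: eq_bigl => i; rewrite !inE -andbA.
  apply: eq_bigl => i; rewrite !inE.
  case iA': (i \in A'); first by rewrite andbF.
  rewrite andbT; case iB: (i \in B) => //.
  by rewrite (fintype.subsetP BA' _ iB) in iA'.
have h0 A' A : 0 <= h A' A by apply: sumr_ge0.
have F0 A' A : 0 <= F A' A by apply: sumr_ge0 => i _; exact: ltW.
(* At high temperature no further set freezes. *)
have [easy|] := boolP [forall A : {set 'I_n}, (B \subset A) ==> (h B A <= F B A)].
  have M1 (A : {set 'I_n}) : ~~ (A \subset B) -> wmax (fun=> 1 : R) (A :\: B) = 1.
    move=> /fintype.subsetPn[i iA iB]; apply: (@wmax_eq _ _ (fun=> 1 : R) _ i) => //.
    by rewrite inE iB.
  exists (fun=> 1); split => [i _|A BA|]; first by rewrite m01.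
  - move/forallP/(_ A)/implyP/(_ BA) : easy; rewrite /h /F; apply: le_trans.
    by apply: ler_sum => l /andP[_ SB]; rewrite M1// expr1n mul1r.
  - rewrite big1; last by move=> i _; rewrite invr1 subrr mulr0.
    by rewrite big1// => l SB; rewrite M1// subrr mulr0.
rewrite negb_forall => /existsP[A0]; rewrite negb_imply -ltNge => /andP[BA0 hA0].
pose Q (A : {set 'I_n}) := (B \subset A) && (0 < h B A).
have QA0 : Q A0 by rewrite /Q BA0 (le_lt_trans (F0 _ _) hA0).
pose rho (A : {set 'I_n}) := F B A / h B A.
case: (arg_minP rho QA0) => A' /andP[BA' hA'] minA'.
have rho1 : rho A' < 1.
  apply: (le_lt_trans (minA' _ QA0)); rewrite /rho ltr_pdivrMr ?mul1r//.
  by case/andP: QA0.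
have [i0 i0A' i0B] : exists2 i0, i0 \in A' & i0 \notin B.
  apply/fintype.subsetPn; apply: contraTN hA' => A'B; rewrite /h big_pred0 ?ltxx// => l.
  by apply/negP => /andP[SA'] /negP; apply; exact: fintype.subset_trans SA' A'B.
have FA' : 0 < F B A'.
  rewrite /F (bigD1 i0)/= ?inE ?i0B//; apply: ltr_pwDl => //.
  by apply: sumr_ge0 => i _; exact: ltW.
have rho0 : 0 < rho A' by rewrite divr_gt0.
pose m := Num.sqrt (rho A').
have m_gt0 : 0 < m by rewrite sqrtr_gt0.
have m2 : m ^+ 2 = rho A' by rewrite sqr_sqrtr// ltW.
have m_le1 : m <= 1 by rewrite -(@sqrtr1 R) ler_wsqrtr// ltW.
have tight : F B A' = m ^+ 2 * h B A' by rewrite m2 /rho divfK// gt_eqF.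
have m0m : m0 <= m.
  rewrite -(ler_pXn2r (n := 2))// ?nnegrE// ?(ltW m_gt0)// m2 /rho.
  by rewrite ler_pdivlMr// hB.
have hm (A : {set 'I_n}) : B \subset A -> m ^+ 2 * h B A <= F B A.
  move=> BA; have [hA|] := ltP 0 (h B A).
    by rewrite m2 -ler_pdivlMr//; apply: minA'; rewrite /Q BA.
  by move=> hA; rewrite (@le_trans _ _ 0)// mulr_ge0_le0// sqr_ge0.
have hkA' : (#|~: A'| < k)%N.
  rewrite -ltnS; apply: leq_trans hk; rewrite ltnS.
  apply: proper_card; apply/fintype.properP; split; first by rewrite finset.setCS.
  by exists i0; rewrite !inE ?i0B// negbK.
(* The hypothesis for the next step: subtract the equality at A'. *)
have hA'm (A : {set 'I_n}) : A' \subset A -> m ^+ 2 * h A' A <= F A' A.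
  move=> A'A; have := hm A (fintype.subset_trans BA' A'A).
  rewrite /h /F (split_L _ A A' BA') (split_I _ A A' BA').
  by rewrite (finset.setIidPr A'A) mulrDr -/(F B A') tight lerD2l.
have [M' [M'1 M'2 M'3]] := IH A' hkA' m (ltW m_gt0) m_le1 hA'm.
pose M i := if i \in A' then m else M' i.
(* A level takes the largest exponent among its blocks, that is, the exponent
   of the last layer that it meets. *)
have MS1 l : S l \subset A' -> ~~ (S l \subset B) -> wmax M (S l :\: B) = m.
  move=> SA' /fintype.subsetPn[i iS iB].
  have iA' := fintype.subsetP SA' _ iS.
  rewrite (@wmax_eq _ _ M _ i) /M ?iA' ?inE ?iB ?(ltW m_gt0)// => j.
  by rewrite inE => /andP[_ jS]; rewrite (fintype.subsetP SA' _ jS).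
have MS2 l : ~~ (S l \subset A') -> wmax M (S l :\: B) = wmax M' (S l :\: A').
  move=> /fintype.subsetPn[i iS iA']; apply/eqP; rewrite eq_le; apply/andP; split.
    apply: wmax_le => [|j]; first exact: wmax_ge0.
    rewrite inE => /andP[jB jS]; rewrite /M; case: ifPn => jA'.
      have [mi _ _] := M'1 _ iA'.
      by apply: (le_trans mi); apply: wmax_ge; rewrite inE iA'.
    by apply: wmax_ge; rewrite inE jA'.
  apply: wmax_le => [|j]; first exact: wmax_ge0.
  rewrite inE => /andP[jA' jS].
  have -> : M' j = M j by rewrite /M (negbTE jA').
  apply: wmax_ge; rewrite inE jS andbT.
  by apply: contraNN jA' => /(fintype.subsetP BA').
have splitT (g : L -> R) : \sum_(l | ~~ (S l \subset B)) g l =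
    \sum_(l | (S l \subset A') && ~~ (S l \subset B)) g l +
    \sum_(l | ~~ (S l \subset A')) g l.
  have := split_L g finset.setT A' BA'; rewrite finset.setTI.
  rewrite (eq_bigl (fun l => ~~ (S l \subset B))); last first.
    by move=> l; rewrite finset.subsetT.
  rewrite [X in _ = _ + X](eq_bigl (fun l => ~~ (S l \subset A')))//.
  by move=> l; rewrite finset.subsetT.
exists M; split.
- move=> i iB; rewrite /M; case: ifPn => [_|iA']; first by split.
  by have [a b c] := M'1 _ iA'; split => //; exact: le_trans m0m a.
- move=> A BA; rewrite (split_L _ A A' BA') (split_I _ A A' BA'); apply: lerD.
    rewrite (eq_bigr (fun l => m ^+ 2 * C l)); last first.
      by move=> l /andP[]; rewrite finset.subsetI => /andP[_ SA'] SB; rewrite MS1.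
    rewrite -mulr_sumr; apply: hm.
    by rewrite finset.subsetI BA BA'.
  rewrite (eq_bigr (fun l => wmax M' (S l :\: A') ^+ 2 * C l)); last first.
    by move=> l /andP[_ SA']; rewrite MS2.
  have := M'2 (A :|: A') (finset.subsetUr _ _).
  have -> : (A :|: A') :\: A' = A :\: A'.
    by apply/setP => i; rewrite !inE; case: (i \in A'); rewrite ?orbF ?andbF.
  apply: le_trans; rewrite [leRHS](bigID (fun l => S l \subset A))/=.
  rewrite -[leLHS]addr0; apply: lerD; last first.
    by apply: sumr_ge0 => l _; rewrite mulr_ge0// sqr_ge0.
  rewrite le_eqVlt; apply/orP; left; apply/eqP; apply: eq_bigl => l.
  case SA: (S l \subset A); rewrite ?andbF ?andbT//=.
  by rewrite (fintype.subset_trans SA (finset.subsetUl _ _)).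
- have /= := split_I (fun i => f i * ((M i)^-1 - 1)) finset.setT A' BA'.
  rewrite !finset.setTD finset.setTI => ->.
  rewrite splitT.
  congr (_ + _); last first.
    rewrite (eq_bigr (fun l => C l * wmax M' (S l :\: A') *
        (1 - wmax M' (S l :\: A')))); last by move=> l SA'; rewrite MS2.
    rewrite -M'3; apply: eq_bigr => i; rewrite inE /M => iA'.
    by rewrite (negbTE iA').
  rewrite (eq_bigr (fun i => f i * (m^-1 - 1))); last first.
    by move=> i; rewrite inE => /andP[_ iA']; rewrite /M iA'.
  rewrite (eq_bigr (fun l => C l * (m * (1 - m)))); last first.
    by move=> l /andP[SA' SB]; rewrite MS1// mulrA.
  rewrite -!mulr_suml -/(F B A') -/(h B A') tight.
  by field; rewrite gt_eqF.
Qed.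

(** * Configurations and the nodes that they visit *)

Definition node (n : nat) (b : 'I_n -> nat) (L : finType)
    (S : L -> {set 'I_n}) (sigma : config b) (l : L) :
    {l : L & subconfig b (S l)} :=
  Tagged (fun l => subconfig b (S l)) (Defs.restrict sigma (S l)).

Definition agree (n : nat) (b : 'I_n -> nat) (A : {set 'I_n})
    (sigma tau : config b) : bool :=
  [forall i, (i \in A) ==> (sigma i == tau i)].

Lemma agreeP (n : nat) (b : 'I_n -> nat) (A : {set 'I_n})
    (sigma tau : config b) :
  reflect (forall i, i \in A -> sigma i = tau i) (agree A sigma tau).
Proof.
apply: (iffP forallP) => [h i iA|h i]; first by have /implyP/(_ iA)/eqP := h i.
by apply/implyP => /h ->.
Qed.

Lemma restrict_eq (n : nat) (b : 'I_n -> nat) (A : {set 'I_n})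
    (sigma tau : config b) :
  (Defs.restrict sigma A == Defs.restrict tau A) = agree A sigma tau.
Proof.
apply/eqP/agreeP => [/ffunP h i iA|h].
  by have := h (exist _ i iA); rewrite !ffunE.
by apply/ffunP => -[i iA]; rewrite !ffunE; exact: h.
Qed.

Lemma node_eq (n : nat) (b : 'I_n -> nat) (L : finType)
    (S : L -> {set 'I_n}) (sigma tau : config b) (l : L) :
  (node S sigma l == node S tau l) = agree (S l) sigma tau.
Proof. by rewrite -restrict_eq /node eq_Tagged. Qed.

Definition set_block (n : nat) (b : 'I_n -> nat) (sigma : config b) (i : 'I_n)
    (v : {ffun 'I_(b i) -> bool}) : config b :=
  [ffun j : 'I_n => eqtype.dfwith sigma v j].

Lemma agree_set_block (n : nat) (b : 'I_n -> nat) (B : {set 'I_n})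
    (sigma tau : config b) (i : 'I_n) (v : {ffun 'I_(b i) -> bool}) :
  i \notin B ->
  agree B tau sigma && (tau i == v) = agree (i |: B) tau (set_block sigma v).
Proof.
move=> iB; apply/andP/agreeP => [[/agreeP h /eqP hv] j|h].
  rewrite in_setU1 ffunE => /orP[/eqP ->|jB]; first by rewrite eqtype.dfwith_in.
  by rewrite eqtype.dfwith_out ?h//; apply: contraNneq iB => ->.
split; last by rewrite (h i) ?ffunE ?eqtype.dfwith_in// setU11.
apply/agreeP => j jB; rewrite (h j) ?in_setU1 ?jB ?orbT// ffunE eqtype.dfwith_out//.
by apply: contraNneq iB => ->.
Qed.

(** Young's inequality, in the form z^r <= r z + (1 - r) for z = e^y. *)
Lemma expR_convex_interp (R : realType) (r y : R) :
  0 <= r -> r <= 1 -> expR (r * y) <= r * expR y + (1 - r).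
Proof.
move=> r0 r1.
have h1 := expR_ge1Dx ((1 - r) * y); have h2 := expR_ge1Dx (- (r * y)).
have -> : expR y = expR (r * y) * expR ((1 - r) * y).
  by rewrite -expRD; congr expR; ring.
have e2 : expR (r * y) * expR (- (r * y)) = 1 by rewrite -expRD subrr expR0.
have e0 : 0 < expR (r * y) := expR_gt0 _.
have key : 1 <= r * expR ((1 - r) * y) + (1 - r) * expR (- (r * y)).
  apply: (@le_trans _ _ (r * (1 + (1 - r) * y) + (1 - r) * (1 + - (r * y)))).
    by lra.
  by apply: lerD; apply: ler_wpM2l => //; rewrite subr_ge0.
have := ler_wpM2l (ltW e0) key; rewrite mulr1 => /le_trans; apply.
rewrite mulrDr mulrCA lerD2l mulrCA e2 mulr1//.
Qed.

(** Subadditivity of the power [m <= 1]: if s is the sum, then s^m is the sum of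
    the a_i s^(m-1), and s^(m-1) <= a_i^(m-1) because a_i <= s.  The index type
    must be inhabited because [ln 0 = 0]. *)
Lemma expR_ln_sum_le (R : realType) (I : finType) (i0 : I) (a : I -> R) (m : R) :
  m <= 1 -> (forall i, 0 < a i) ->
  expR (m * ln (\sum_i a i)) <= \sum_i expR (m * ln (a i)).
Proof.
move=> m1 a0; set s := \sum_i a i.
have ale i : a i <= s.
  by rewrite /s (bigD1 i)//= lerDl sumr_ge0// => j _; exact: ltW.
have s0 : 0 < s by apply: lt_le_trans (a0 i0) (ale i0).
have -> : expR (m * ln s) = s * expR ((m - 1) * ln s).
  by rewrite -{2}(lnK (x := s)) ?posrE// -expRD; congr expR; ring.
rewrite {1}/s mulr_suml; apply: ler_sum => i _.
have -> : expR (m * ln (a i)) = a i * expR ((m - 1) * ln (a i)).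
  by rewrite -{2}(lnK (x := a i)) ?posrE// -expRD; congr expR; ring.
rewrite ler_pM2l// ler_expR ler_wnM2l//; first by rewrite subr_le0.
by rewrite ler_ln ?posrE.
Qed.

(** Jensen's inequality for the power [theta / m], weighted by [Y].  Using the
    tangent line at the bound itself keeps everything linear in the moment of
    order [m], so no conditional expectation is involved. *)
Lemma moment_interpolation (R : realType) (d : measure_display)
    (T : measurableType d) (P : probability T R) (Y zeta : T -> R)
    (y kap theta m : R) :
  measurable_fun setT Y -> (forall w, 0 <= Y w) ->
  (\int[P]_w (Y w)%:E = y%:E)%E ->
  measurable_fun setT zeta -> 0 < theta -> theta <= m ->
  (\int[P]_w (Y w * expR (m * zeta w))%:E <= (y * expR (m * kap))%:E)%E ->
  (\int[P]_w (Y w * expR (theta * zeta w))%:E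
     <= (y * expR (theta * kap))%:E)%E.
Proof.
move=> mY Y0 EY mz th0 thm hm.
have m0 : 0 < m by exact: lt_le_trans thm.
pose r := theta / m.
have rm : r * m = theta by rewrite divfK// gt_eqF.
have r0 : 0 <= r by rewrite ltW// divr_gt0.
have r1 : r <= 1 by rewrite ler_pdivrMr// mul1r.
have me c : measurable_fun setT (fun w => Y w * expR (c * zeta w)).
  by apply: measurable_funM => //; apply: measurableT_comp => //; exact: measurable_funM.
apply: (@le_trans _ _ (\int[P]_w
  ((r * expR ((theta - m) * kap))%:E * (Y w * expR (m * zeta w))%:E
   + ((1 - r) * expR (theta * kap))%:E * (Y w)%:E))%E).
  apply: ge0_le_integral => //.
  - by move=> w _; rewrite lee_fin mulr_ge0 ?expR_ge0.
  - by apply/measurable_EFinP.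
  - apply: emeasurable_funD; apply: emeasurable_funM => //; exact/measurable_EFinP.
  - move=> w _; rewrite -!EFinM -EFinD lee_fin.
    have := expR_convex_interp (m * (zeta w - kap)) r0 r1.
    rewrite mulrA rm => /(ler_wpM2l (expR_ge0 (theta * kap))).
    rewrite -expRD => /(ler_wpM2l (Y0 w)).
    have -> : theta * kap + theta * (zeta w - kap) = theta * zeta w by ring.
    move=> /le_trans; apply.
    have -> : expR ((theta - m) * kap) = expR (theta * kap) * expR (- (m * kap)).
      by rewrite -expRD; congr expR; ring.
    have -> : expR (m * (zeta w - kap)) = expR (m * zeta w) * expR (- (m * kap)).
      by rewrite -expRD; congr expR; ring.
    by rewrite le_eqVlt; apply/orP; left; apply/eqP; ring.
have c1 : 0 <= r * expR ((theta - m) * kap) by rewrite mulr_ge0 ?expR_ge0.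
have c2 : 0 <= (1 - r) * expR (theta * kap) by rewrite mulr_ge0 ?expR_ge0 ?subr_ge0.
rewrite ge0_integralD//; last 4 first.
- move=> w _; apply: mule_ge0; rewrite lee_fin//.
  by apply: mulr_ge0; rewrite ?expR_ge0.
- by apply: emeasurable_funM => //; apply/measurable_EFinP.
- by move=> w _; apply: mule_ge0; rewrite lee_fin.
- by apply: emeasurable_funM => //; apply/measurable_EFinP.
rewrite !ge0_integralZl_EFin//; last 4 first.
- by move=> w _; rewrite lee_fin.
- by apply/measurable_EFinP.
- by move=> w _; rewrite lee_fin mulr_ge0 ?expR_ge0.
- by apply/measurable_EFinP.
rewrite EY -EFinM.
apply: (@le_trans _ _ ((r * expR ((theta - m) * kap))%:E * (y * expR (m * kap))%:E
  + ((1 - r) * expR (theta * kap) * y)%:E)%E).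
  by rewrite leeD2r// lee_wpmul2l// lee_fin.
rewrite -EFinM -EFinD lee_fin.
have -> : expR ((theta - m) * kap) = expR (theta * kap) * expR (- (m * kap)).
  by rewrite -expRD; congr expR; ring.
have e2 : expR (m * kap) * expR (- (m * kap)) = 1 by rewrite -expRD subrr expR0.
rewrite le_eqVlt; apply/orP; left; apply/eqP.
transitivity (r * y * expR (theta * kap) * (expR (m * kap) * expR (- (m * kap)))
  + (1 - r) * expR (theta * kap) * y); first by ring.
by rewrite e2; ring.
Qed.

Lemma measurable_sum_cond (R : realType) (d : measure_display)
    (T : measurableType d) (I : finType) (Q : pred I) (f : I -> T -> R) :
  (forall i, measurable_fun setT (f i)) ->
  measurable_fun setT (fun w => \sum_(i | Q i) f i w).
Proof.
move=> mf; under eq_fun do rewrite -big_filter.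
exact: measurable_sum.
Qed.

(** The partition function that remains when the blocks in [B] are frozen to
    their values in [sigma]; levels inside [B] are then constants and are left
    out. *)
Definition residual_partition (R : realType) (n : nat) (b : 'I_n -> nat)
    (L : finType) (S : L -> {set 'I_n}) (h : L -> R) (B : {set 'I_n})
    (x : {l : L & subconfig b (S l)} -> R) (sigma : config b) : R :=
  \sum_(tau | agree B tau sigma)
     expR (\sum_(l | ~~ (S l \subset B)) h l * x (node S tau l)).

Lemma residual_partition_gt0 (R : realType) (n : nat) (b : 'I_n -> nat)
    (L : finType) (S : L -> {set 'I_n}) (h : L -> R) (B : {set 'I_n})
    (x : {l : L & subconfig b (S l)} -> R) (sigma : config b) :
  0 < residual_partition h B x sigma.
Proof.
rewrite /residual_partition (bigD1 sigma)/=; last exact/agreeP.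
by rewrite ltr_pwDl ?expR_gt0// sumr_ge0// => tau _; exact: expR_ge0.
Qed.

(** Summing first over the value of block [i]. *)
Lemma residual_partition_rec (R : realType) (n : nat) (b : 'I_n -> nat)
    (L : finType) (S : L -> {set 'I_n}) (h : L -> R) (B : {set 'I_n})
    (x : {l : L & subconfig b (S l)} -> R) (sigma : config b) (i : 'I_n) :
  i \notin B ->
  residual_partition h B x sigma =
  \sum_(v : {ffun 'I_(b i) -> bool})
     expR (\sum_(l | (S l \subset i |: B) && ~~ (S l \subset B))
             h l * x (node S (set_block sigma v) l))
     * residual_partition h (i |: B) x (set_block sigma v).
Proof.
move=> iB; rewrite /residual_partition (partition_big (fun tau : config b => tau i) xpredT)//=.
apply: eq_bigr => v _; rewrite mulr_sumr.
apply: eq_big => tau; first by rewrite agree_set_block.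
rewrite agree_set_block// => /agreeP htau.
rewrite -expRD; congr expR; rewrite (bigID (fun l => S l \subset i |: B))/=.
congr (_ + _).
  apply: eq_big => l; first by rewrite andbC.
  move=> /andP[_ SB']; congr (_ * x _); apply/eqP; rewrite node_eq.
  by apply/agreeP => j /(fintype.subsetP SB'); exact: htau.
apply: eq_bigl => l; rewrite andb_idl// => /negP SB'; apply/negP => SB; apply: SB'.
by apply: fintype.subset_trans SB _; exact: finset.subsetUr.
Qed.

Lemma measurable_ln_residual_partition (R : realType) (d : measure_display)
    (T : measurableType d) (P : probability T R)
    (n : nat) (b : 'I_n -> nat)
    (L : finType) (S : L -> {set 'I_n}) (h : L -> R) (B : {set 'I_n})
    (X : {l : L & subconfig b (S l)} -> {RV P >-> R}) (sigma : config b) :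
  measurable_fun setT (fun w => ln (residual_partition h B (fun x => X x w) sigma)).
Proof.
apply: measurableT_comp => //; apply: measurable_sum_cond => tau.
apply: measurableT_comp => //; apply: measurable_sum_cond => l.
exact: measurable_funM.
Qed.

(** * Fractional moments of the partition function *)

(** The exponent gained by summing out the blocks outside [B]: entropy
    contributes [b i * ln 2 / M i], and a Gaussian of variance [v] with
    coefficient [h l], raised to the power m, has mean e^(m^2 v h^2 / 2). *)
Definition moment_rate (R : realType) (n : nat) (b : 'I_n -> nat)
    (L : finType) (S : L -> {set 'I_n}) (h : L -> R) (v : R) (M : 'I_n -> R)
    (B : {set 'I_n}) : R :=
  \sum_(i in ~: B) (b i)%:R * ln 2 / M i
  + \sum_(l | ~~ (S l \subset B)) wmax M (S l) * (v * h l ^+ 2 / 2).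

Lemma moment_rate_rec (R : realType) (n : nat) (b : 'I_n -> nat)
    (L : finType) (S : L -> {set 'I_n}) (h : L -> R) (v : R) (M : 'I_n -> R)
    (B : {set 'I_n}) (i : 'I_n) :
  i \notin B -> (forall j, j \in B -> M j <= M i) -> 0 < M i ->
  M i * moment_rate b S h v M B =
  (b i)%:R * ln 2
  + \sum_(l | (S l \subset i |: B) && ~~ (S l \subset B))
       v * (M i * h l) ^+ 2 / 2
  + M i * moment_rate b S h v M (i |: B).
Proof.
move=> iB hM Mi; rewrite /moment_rate.
rewrite (bigD1 i)/=; last by rewrite inE.
rewrite (bigID (fun l => S l \subset i |: B) (fun l => ~~ (S l \subset B)))/=.
have -> : \sum_(l | ~~ (S l \subset B) && (S l \subset i |: B))
    wmax M (S l) * (v * h l ^+ 2 / 2) =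
  M i * \sum_(l | (S l \subset i |: B) && ~~ (S l \subset B)) v * h l ^+ 2 / 2.
  rewrite mulr_sumr; apply: eq_big => l; first by rewrite andbC.
  move=> /andP[SB SB']; congr (_ * _).
  have iS : i \in S l.
    apply: contraNT SB => iS; apply/fintype.subsetP => j jS.
    move/fintype.subsetP/(_ _ jS) : SB'; rewrite in_setU1 => /orP[/eqP ji|//].
    by rewrite -ji jS in iS.
  apply: wmax_eq => //; first exact: ltW.
  move=> j jS; move/fintype.subsetP/(_ _ jS) : SB'; rewrite in_setU1.
  by move=> /orP[/eqP -> //|/hM].
have -> : \sum_(l | ~~ (S l \subset B) && ~~ (S l \subset i |: B))
    wmax M (S l) * (v * h l ^+ 2 / 2) =
  \sum_(l | ~~ (S l \subset i |: B)) wmax M (S l) * (v * h l ^+ 2 / 2).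
  apply: eq_bigl => l; rewrite andb_idl// => /negP SB'; apply/negP => SB; apply: SB'.
  by apply: fintype.subset_trans SB _; exact: finset.subsetUr.
have -> : \sum_(j in ~: B | j != i) (b j)%:R * ln 2 / M j =
    \sum_(j in ~: (i |: B)) (b j)%:R * ln 2 / M j.
  by apply: eq_bigl => j; rewrite !inE negb_or andbC.
have -> : \sum_(l | (S l \subset i |: B) && ~~ (S l \subset B))
    v * (M i * h l) ^+ 2 / 2 = M i ^+ 2 *
    \sum_(l | (S l \subset i |: B) && ~~ (S l \subset B)) v * h l ^+ 2 / 2.
  by rewrite mulr_sumr; apply: eq_bigr => l _; ring.
by field; rewrite gt_eqF.
Qed.

(** The upper bound proper, by induction on the number of blocks outside [B].
    The block [i] with the least exponent is summed out first, at the power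
    [M i].  The factor with coefficients [t] carries the levels already met; as
    these are inside [B], they are independent of the levels met later, and the
    Laplace transform of independent Gaussians factorises. *)
Lemma partition_moment (R : realType) (d : measure_display)
    (T : measurableType d) (P : probability T R)
    (n : nat) (b : 'I_n -> nat)
    (L : finType) (S : L -> {set 'I_n}) (h : L -> R)
    (X : {l : L & subconfig b (S l)} -> {RV P >-> R}) (v : R) (M : 'I_n -> R) :
  0 < v -> iid_normal 0 v X ->
  (forall i, 0 < M i) -> (forall i, M i <= 1) ->
  forall (B : {set 'I_n}) (theta : R) (sigma : config b)
    (t : {l : L & subconfig b (S l)} -> R),
  (forall i j, i \in B -> j \notin B -> M i <= M j) ->
  0 < theta -> (forall j, j \notin B -> theta <= M j) ->
  (forall x, ~~ (S (tag x) \subset B) -> t x = 0) ->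
  (\int[P]_w (expR (\sum_x t x * X x w)
      * expR (theta * ln (residual_partition h B (fun x => X x w) sigma)))%:E
   <= (expR (\sum_x v * t x ^+ 2 / 2)
       * expR (theta * moment_rate b S h v M B))%:E)%E.
Proof.
move=> v0 iidX M0 M1 B; have [k] := ubnP #|~: B|.
elim: k B => // k IH B hk theta sigma t hB th0 thM ht.
have mY (t' : {l : L & subconfig b (S l)} -> R) :
    measurable_fun setT (fun w => expR (\sum_x t' x * X x w)).
  apply: measurableT_comp => //; apply: measurable_sum_cond => x.
  exact: measurable_funM.
have [BT|/set0Pn[i0]] := eqVneq (~: B) finset.set0.
  have BE : B = [set: 'I_n]%SET by rewrite -(finset.setCK B) BT finset.setC0.
  have -> : moment_rate b S h v M B = 0.
    rewrite /moment_rate BT big_set0 big1 ?addr0// => l.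
    by rewrite BE finset.subsetT.
  rewrite mulr0 expR0 mulr1 -(integral_expR_iid_normal _ v0 iidX).
  rewrite le_eqVlt; apply/orP; left; apply/eqP; apply: eq_integral => w _.
  rewrite (_ : residual_partition _ _ _ _ = 1) ?ln1 ?mulr0 ?expR0 ?mulr1//.
  rewrite /residual_partition (bigD1 sigma)/=; last exact/agreeP.
  rewrite [X in expR X]big1; last by move=> l; rewrite BE finset.subsetT.
  rewrite expR0 big1 ?addr0// => tau /andP[/agreeP h1 /eqP h2]; exfalso.
  by apply: h2; apply/ffunP => j; rewrite h1// BE finset.in_setT.
rewrite inE => i0B.
case: (@arg_minP _ _ _ i0 (fun i => i \notin B) M i0B) => i iB imin.
have m1 := M1 i; have m0 := M0 i; set m := M i in m1 m0.
apply: (@moment_interpolation _ _ _ _ _ _ _ _ _ m) => //.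
- exact: integral_expR_iid_normal.
- exact: measurable_ln_residual_partition.
- exact: thM.
have hk' : (#|~: (i |: B)| < k)%N.
  rewrite -ltnS; apply: leq_trans hk; rewrite ltnS.
  apply: proper_card; apply/fintype.properP; split.
    by rewrite finset.setCS finset.subsetUr.
  by exists i; rewrite !inE ?eqxx.
pose lay l := (S l \subset i |: B) && ~~ (S l \subset B).
(* The levels that become determined once block i is known join the Gaussian
   factor, with coefficient m * h. *)
pose t' (u : {ffun 'I_(b i) -> bool}) x := t x + \sum_(l | lay l)
  m * h l * (x == node S (set_block sigma u) l)%:R.
have tE u x : v * t' u x ^+ 2 / 2 = v * t x ^+ 2 / 2 + \sum_(l | lay l)
    v * (m * h l) ^+ 2 / 2 * (x == node S (set_block sigma u) l)%:R.
  rewrite /t'; have [/andP[l1 l2]|nl] := boolP (lay (tag x)); last first.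
    rewrite !big1 ?addr0// => l hl; case: eqP => [xE|]; rewrite ?mulr0//.
      by rewrite xE hl in nl.
    by rewrite xE hl in nl.
  have single (F : L -> R) :
      \sum_(l | lay l) F l * (x == node S (set_block sigma u) l)%:R =
      F (tag x) * (x == node S (set_block sigma u) (tag x))%:R.
    rewrite (bigD1 (tag x))/=; last by rewrite /lay l1.
    rewrite big1 ?addr0// => l /andP[_ /eqP lx]; case: eqP => [xE|]; rewrite ?mulr0//.
    by rewrite xE in lx.
  rewrite ht// !single; case: eqP => _.
    by rewrite !mulr1 expr0n/= add0r mulr0 mul0r add0r.
  by rewrite !mulr0 addr0 expr0n/= mulr0 mul0r addr0.
have sumt u : \sum_x v * t' u x ^+ 2 / 2 = \sum_x v * t x ^+ 2 / 2 +
    \sum_(l | lay l) v * (m * h l) ^+ 2 / 2.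
  under eq_bigr do rewrite tE.
  rewrite big_split/=; congr (_ + _); rewrite exchange_big/=.
  apply: eq_bigr => l _; rewrite (bigD1 (node S (set_block sigma u) l))//= eqxx mulr1.
  by rewrite big1 ?addr0// => x /negbTE ->; rewrite mulr0.
have bound u w : expR (\sum_x t x * X x w) *
   expR (m * ln (expR (\sum_(l | (S l \subset i |: B) && ~~ (S l \subset B))
             h l * X (node S (set_block sigma u) l) w)
     * residual_partition h (i |: B) (fun x => X x w) (set_block sigma u))) =
   expR (\sum_x t' u x * X x w) *
   expR (m * ln (residual_partition h (i |: B) (fun x => X x w) (set_block sigma u))).
  rewrite lnM ?posrE ?expR_gt0 ?residual_partition_gt0// expRK mulrDr expRD mulrA.
  congr (_ * _); rewrite -expRD; congr expR; rewrite /t'.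
  under [RHS]eq_bigr do rewrite mulrDl.
  rewrite big_split/=; congr (_ + _).
  rewrite mulr_sumr.
  under [RHS]eq_bigr do rewrite mulr_suml.
  rewrite exchange_big/=; apply: eq_bigr => l _.
  rewrite (bigD1 (node S (set_block sigma u) l))//= eqxx mulr1 big1 ?addr0 ?mulrA//.
  by move=> x /negbTE ->; rewrite mulr0 mul0r.
pose G u w := expR (\sum_x t' u x * X x w) *
  expR (m * ln (residual_partition h (i |: B) (fun x => X x w) (set_block sigma u))).
have mG u : measurable_fun setT (G u).
  apply: measurable_funM => //; apply: measurableT_comp => //.
  by apply: measurable_funM => //; exact: measurable_ln_residual_partition.
apply: (@le_trans _ _ (\int[P]_w (\sum_u (G u w)%:E))%E).
  apply: ge0_le_integral => //.
  - apply/measurable_EFinP; apply: measurable_funM => //; apply: measurableT_comp => //.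
    by apply: measurable_funM => //; exact: measurable_ln_residual_partition.
  - by apply: emeasurable_sum => u; exact/measurable_EFinP.
  - move=> w _; rewrite sumEFin lee_fin (residual_partition_rec _ _ _ iB).
    under [leRHS]eq_bigr do rewrite /G -bound.
    rewrite -mulr_sumr ler_wpM2l ?expR_ge0//.
    apply: (expR_ln_sum_le [ffun=> true]) => // u.
    by rewrite mulr_gt0 ?expR_gt0 ?residual_partition_gt0.
rewrite ge0_integral_sum//; last first.
- by move=> u w _; rewrite lee_fin mulr_ge0 ?expR_ge0.
- by move=> u; exact/measurable_EFinP.
apply: (@le_trans _ _ (\sum_(u : {ffun 'I_(b i) -> bool})
  (expR (\sum_x v * t x ^+ 2 / 2 + \sum_(l | lay l) v * (m * h l) ^+ 2 / 2)
   * expR (m * moment_rate b S h v M (i |: B)))%:E)%E).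
  apply: lee_sum => u _; rewrite -(sumt u); apply: IH => //.
  - move=> j1 j2; rewrite !in_setU1 negb_or => /orP[/eqP ->|j1B] /andP[_ j2B].
      exact: imin.
    exact: hB.
  - by move=> j; rewrite in_setU1 negb_or => /andP[_ jB]; exact: imin.
  - move=> x xB; rewrite /t' ht ?add0r; last first.
      apply: contraNN xB => xB; apply: fintype.subset_trans xB _.
      exact: finset.subsetUr.
    rewrite big1// => l /andP[l1 _]; case: eqP => [xE|]; rewrite ?mulr0//.
    by rewrite xE /= l1 in xB.
rewrite sumEFin lee_fin sumr_const card_ffun card_bool card_ord.
have hBi j : j \in B -> M j <= M i by move=> jB; exact: hB.
have := moment_rate_rec b S h v iB hBi (M0 i); rewrite -/m => ->.
rewrite !expRD -[leLHS]mulr_natr natrX.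
have -> : expR ((b i)%:R * ln 2) = 2 ^+ b i :> R.
  by rewrite expRM_natl lnK ?posrE.
by rewrite le_eqVlt; apply/orP; left; apply/eqP; ring.
Qed.

(** * Almost sure upper bound *)

Lemma markov_bound (R : realType) (d : measure_display)
    (T : measurableType d) (P : probability T R) (B : set T) (f : T -> R)
    (K c : R) :
  measurable B -> measurable_fun setT f -> (forall w, 0 <= f w) -> 0 < c ->
  (forall w, B w -> c <= f w) -> (\int[P]_w (f w)%:E <= K%:E)%E ->
  (P B <= (K / c)%:E)%E.
Proof.
move=> mB mf f0 c0 hB hK.
have : (c%:E * P B <= K%:E)%E.
  apply: le_trans hK.
  rewrite -(setIT B) -(integral_indic P measurableT mB).
  have mI : measurable_fun setT (fun w => (\1_B w : R)%:E).
    by apply/measurable_EFinP; exact: measurable_indic.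
  rewrite -(ge0_integralZl_EFin P measurableT _ mI) ?(ltW c0)//.
  apply: ge0_le_integral => //.
  - by move=> w _; apply: mule_ge0; rewrite lee_fin// ltW.
  - exact: emeasurable_funM.
  - exact/measurable_EFinP.
  - move=> w _; rewrite -EFinM lee_fin indicE.
    have [/set_mem wB|_] := boolP (w \in B); first by rewrite mulr1 hB.
    by rewrite mulr0.
by rewrite -lee_pdivlMl// EFinM muleC.
Qed.

(** At [S := val] this is [bk_hamiltonian] and at [S i := prefix_set pi i.+1],
    with the weights of the tree, it is [tree_hamiltonian], both up to
    conversion. *)
Definition model_hamiltonian (R : realType) (n : nat) (b : 'I_n -> nat)
    (N : nat) (L : finType) (S : L -> {set 'I_n}) (c : L -> R)
    (x : {l : L & subconfig b (S l)} -> R) (sigma : config b) : R :=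
  N%:R * \sum_l c l * x (node S sigma l).

(** The limit of [moment_rate] per unit of N, at no frozen block and
    [h l = - (beta * N * c l)]. *)
Definition upper_rate (R : realType) (n : nat) (p : 'I_n -> R) (beta : R)
    (L : finType) (S : L -> {set 'I_n}) (c : L -> R) (M : 'I_n -> R) : R :=
  \sum_i p i * ln 2 / M i + \sum_l wmax M (S l) * (beta ^+ 2 * c l ^+ 2 / 2).

Lemma free_energy_residual_partition (R : realType) (n : nat) (b : 'I_n -> nat)
    (N : nat) (beta : R) (L : finType) (S : L -> {set 'I_n}) (c : L -> R)
    (x : {l : L & subconfig b (S l)} -> R) (sigma : config b) :
  (forall l, S l != finset.set0) ->
  free_energy N beta (model_hamiltonian N c x) =
  N%:R^-1 * ln (residual_partition (fun l => - (beta * N%:R * c l)) finset.set0 x sigma).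
Proof.
move=> S0; congr (_ * ln _); apply: eq_big => tau.
  by apply/esym/agreeP => i; rewrite finset.in_set0.
move=> _; congr expR; rewrite /model_hamiltonian mulrA mulr_sumr.
apply: eq_big => l; first by rewrite finset.subset0 S0.
by move=> _; ring.
Qed.

Lemma cvg_sumr (R : realType) (I : finType) (u : I -> nat -> R) (l : I -> R) :
  (forall i, u i N @[N --> \oo] --> l i) ->
  \sum_i u i N @[N --> \oo] --> \sum_i l i.
Proof. by move=> h; apply: cvg_big => // ; exact: add_continuous. Qed.

(** Markov's inequality for the moment of order [theta], any positive number
    below all exponents. *)
Lemma ae_free_energy_le (R : realType) (d : measure_display)
    (T : measurableType d) (P : probability T R)
    (n : nat) (k : nat -> 'I_n -> nat) (p : 'I_n -> R) (beta : R)
    (L : finType) (S : L -> {set 'I_n}) (c : L -> R)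
    (X : forall N, {l : L & subconfig (k N) (S l)} -> {RV P >-> R})
    (N0 : nat) (M : 'I_n -> R) (eps : R) :
  (forall l, S l != finset.set0) ->
  (forall i, (k N i)%:R / N%:R @[N --> \oo] --> p i) ->
  (forall N, (N0 <= N)%N -> iid_normal 0 N%:R^-1 (@X N)) ->
  (forall i, 0 < M i) -> (forall i, M i <= 1) -> 0 < eps ->
  {ae P, forall w, \forall N \near \oo,
     free_energy N beta (model_hamiltonian N c (fun x => X N x w))
       <= upper_rate p beta S c M + eps}.
Proof.
move=> S0 hkp iidX M0 M1 eps0.
pose sigma0 N : config (k N) := [ffun i : 'I_n => [ffun=> true]].
pose hN N l := - (beta * N%:R * c l).
pose Z N w := ln (residual_partition (hN N) finset.set0 (fun x => X N x w) (sigma0 N)).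
set U := upper_rate p beta S c M.
pose F N := [set w | U + eps < N%:R^-1 * Z N w].
have mZ N : measurable_fun setT (Z N) by exact: measurable_ln_residual_partition.
have mF N : measurable (F N).
  have mf : measurable_fun setT (fun w => N%:R^-1 * Z N w) by exact: measurable_funM.
  have -> : F N = setT `&` (fun w => N%:R^-1 * Z N w) @^-1` `]U + eps, +oo[%classic.
    by rewrite setTI; apply/seteqP; split=> w /=; rewrite in_itv/= andbT.
  exact: mf.
pose theta := \prod_i M i.
have th0 : 0 < theta by apply: prodr_gt0.
have thM j : theta <= M j.
  rewrite /theta (bigD1 j)//= ler_piMr ?(ltW (M0 j))//.
  by apply: prodr_ile1 => i _; rewrite M1 ltW.
pose K N := \sum_i ((k N i)%:R / N%:R) * (ln 2 / M i)
  + \sum_l wmax M (S l) * (beta ^+ 2 * c l ^+ 2 / 2).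
have Kcvg : K N @[N --> \oo] --> U.
  apply: cvgD; last exact: cvg_cst.
  under [X in _ --> X]eq_bigr do rewrite -mulrA.
  by apply: cvg_sumr => i; apply: cvgMl; exact: hkp.
have [N1 _ hN1] : \forall N \near \oo, K N <= U + eps / 2.
  have e2 : 0 < eps / 2 by rewrite divr_gt0.
  move/cvgr_le : Kcvg; apply; by rewrite ltrDl.
have rate N : (0 < N)%N ->
    moment_rate (k N) S (hN N) N%:R^-1 M finset.set0 = N%:R * K N.
  move=> N_gt0; have NR : N%:R != 0 :> R by rewrite pnatr_eq0 -lt0n.
  rewrite /moment_rate /K mulrDr !mulr_sumr; congr (_ + _).
    apply: eq_big => i; first by rewrite finset.setC0 finset.in_setT.
    by move=> _; field; rewrite NR gt_eqF.
  apply: eq_big => l; first by rewrite finset.subset0 S0.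
  by move=> _; rewrite /hN; field.
have : {ae P, forall w, \forall N \near \oo, ~ F N w}.
  apply: (@ae_eventually_not _ _ _ _ F 1 (theta * (eps / 2)) (maxn N0 (maxn N1 1))) => //.
    by rewrite mulr_gt0// divr_gt0.
  move=> N; rewrite !geq_max => /and3P[hN0 hNN1 N_gt0].
  have NR : 0 < N%:R :> R by rewrite ltr0n.
  have := @partition_moment _ _ _ P _ (k N) L S (hN N) (@X N) N%:R^-1 M _
    (iidX N hN0) M0 M1 finset.set0 theta (sigma0 N) (fun=> 0).
  rewrite invr_gt0 => /(_ NR) /=.
  have -> : \sum_(x : {l : L & subconfig (k N) (S l)}) N%:R^-1 * 0 ^+ 2 / 2 = 0 :> R.
    by rewrite big1// => x _; rewrite expr0n/= mulr0 mul0r.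
  rewrite expR0 mul1r rate// => H.
  have {}H : (\int[P]_w (expR (theta * Z N w))%:E
      <= (expR (theta * (N%:R * K N)))%:E)%E.
    apply: le_trans (H _ _ _ _) => //; last first.
      by move=> i j; rewrite finset.in_set0.
    rewrite le_eqVlt; apply/orP; left; apply/eqP; apply: eq_integral => w _.
    by rewrite big1 ?expR0 ?mul1r// => x _; rewrite mul0r.
  apply: le_trans (markov_bound (c := expR (theta * (N%:R * (U + eps)))) _ _ _ _ _ H) _ => //.
  - by apply: measurableT_comp => //; exact: measurable_funM.
  - exact: expR_gt0.
  - move=> w /ltW; rewrite ler_pdivlMl// => hw.
    by rewrite ler_expR ler_pM2l.
  - rewrite lee_fin mul1r -expRN -expRD ler_expR.
    have KN := hN1 _ hNN1.
    have : theta * (N%:R * K N) <= theta * (N%:R * (U + eps / 2)).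
      by rewrite ler_pM2l// ler_pM2l.
    lra.
apply: filterS => w; apply: filterS => N /negP; rewrite -leNgt.
by rewrite (free_energy_residual_partition _ _ _ _ (sigma0 N)).
Qed.

(** * Second moment of the number of deep configurations *)

Lemma card_config (n : nat) (b : 'I_n -> nat) :
  #|config b| = (2 ^ (\sum_i b i))%N.
Proof.
rewrite expn_sum card_dep_ffun foldrE big_image/=; apply: eq_bigr => i _.
by rewrite card_ffun card_bool card_ord.
Qed.

Lemma card_agree (n : nat) (b : 'I_n -> nat) (A : {set 'I_n}) (sigma : config b) :
  (#|[pred tau : config b | agree A tau sigma]| * 2 ^ (\sum_(i in A) b i)
    = #|config b|)%N.
Proof.
pose F (i : 'I_n) : pred {ffun 'I_(b i) -> bool} :=
  fun x => (i \in A) ==> (x == sigma i).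
have -> : #|[pred tau : config b | agree A tau sigma]| = (\prod_i #|F i|)%N.
  transitivity #|(family F : simpl_pred (config b))|.
    apply: eq_card => tau; rewrite [LHS]inE; apply/agreeP/familyP => [h i|h i iA].
      by apply/implyP => /h ->.
    by have /implyP/(_ iA)/eqP := h i.
  by rewrite card_family foldrE big_image.
rewrite card_config !expn_sum [X in (_ * X)%N]big_mkcond -big_split/=; apply: eq_bigr => i _.
case: ifP => iA.
  rewrite (@fintype.eq_card1 _ (sigma i)) ?mul1n// => x.
  by rewrite !inE /F iA.
rewrite muln1 (eq_card (B := predT)); last by move=> x; rewrite !inE /F iA.
by rewrite card_ffun card_bool card_ord.
Qed.

Lemma bigsetIP (T : Type) (K : finType) (J : {set K}) (E : K -> set T) w :
  (\big[setI/setT]_(x in J) E x) w <-> (forall x, x \in J -> E x w).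
Proof.
rewrite -big_enum; split => [|h].
  move=> h x; rewrite -mem_enum; elim: (enum J) h => // y s IH.
  rewrite big_cons => -[Ey h]; rewrite inE => /orP[/eqP -> //|]; exact: IH.
have {}h x : x \in enum J -> E x w by rewrite mem_enum; exact: h.
elim: (enum J) h => [|y s IH] h; first by rewrite big_nil.
rewrite big_cons; split; first by apply: h; rewrite inE eqxx.
by apply: IH => x xs; apply: h; rewrite inE xs orbT.
Qed.

(** The nodes shared by two configurations are those of the levels inside their
    agreement set. *)
Definition agreement (n : nat) (b : 'I_n -> nat) (sigma tau : config b) :
  {set 'I_n} := [set i | sigma i == tau i]%SET.

Lemma agree_sub (n : nat) (b : 'I_n -> nat) (A : {set 'I_n})
    (sigma tau : config b) :
  agree A sigma tau = (A \subset agreement sigma tau).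
Proof.
apply/agreeP/fintype.subsetP => h i /h; first by rewrite inE => ->.
by rewrite inE => /eqP.
Qed.

Definition nodes (n : nat) (b : 'I_n -> nat) (L : finType)
    (S : L -> {set 'I_n}) (sigma : config b) : {set {l : L & subconfig b (S l)}} :=
  [set node S sigma l | l : L]%SET.

Lemma node_inj (n : nat) (b : 'I_n -> nat) (L : finType)
    (S : L -> {set 'I_n}) (sigma : config b) : injective (node S sigma).
Proof. by move=> l1 l2 /(congr1 tag). Qed.

(** Each shared node is counted once instead of twice, which costs one factor
    [q l] for every level inside the agreement set. *)
Lemma prod_nodesU (R : realType) (n : nat) (b : 'I_n -> nat) (L : finType)
    (S : L -> {set 'I_n}) (q : L -> R) (sigma tau : config b) :
  (forall l, 0 < q l) ->
  \prod_(x in nodes S sigma :|: nodes S tau) q (tag x)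
  = (\prod_l q l) ^+ 2 * \prod_(l | S l \subset agreement sigma tau) (q l)^-1.
Proof.
move=> q0.
have prodn (s : config b) : \prod_(x in nodes S s) q (tag x) = \prod_l q l.
  rewrite /nodes big_imset/=; last by move=> ? ? _ _; exact: node_inj.
  by apply: eq_bigl => l; rewrite inE.
have prodI : \prod_(x in nodes S sigma :&: nodes S tau) q (tag x) =
    \prod_(l | S l \subset agreement sigma tau) q l.
  rewrite (_ : _ :&: _ =
    [set node S sigma l | l in [pred l | S l \subset agreement sigma tau]]%SET).
    by rewrite big_imset//= => ? ? _ _; exact: node_inj.
  apply/setP => x; rewrite finset.in_setI; apply/andP/imsetP.
    move=> [/imsetP[l _ ->] /imsetP[l' _ e]]; exists l => //.
    have ll' : l = l' by have := congr1 tag e.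
    rewrite inE -agree_sub -node_eq; apply/eqP; rewrite ll' in e *; exact: e.
  move=> [l]; rewrite inE => hl ->; split; apply/imsetP; exists l => //.
  by apply/eqP; rewrite node_eq agree_sub.
have I0 : \prod_(l | S l \subset agreement sigma tau) q l != 0.
  by rewrite gt_eqF// prodr_gt0.
rewrite prodfV; apply: (mulIf I0); rewrite mulfVK// -prodI.
rewrite (big_setID (nodes S sigma))/= finset.setUK.
rewrite (prodn sigma) expr2 -mulrA; congr (_ * _).
rewrite -[RHS](prodn tau) [RHS](big_setID (nodes S sigma))/=.
rewrite finset.setDUl finset.setDv finset.set0U mulrC; congr (_ * _).
by rewrite finset.setIC.
Qed.

(** All the Gaussians seen by [sigma] are at most [- y]: the energies are
    negative because the free energy weighs by [- beta]. *)
Definition deep_event (R : realType) (T : Type) (n : nat) (b : 'I_n -> nat)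
    (L : finType) (S : L -> {set 'I_n}) (y : L -> R)
    (X : {l : L & subconfig b (S l)} -> T -> R) (sigma : config b) : set T :=
  \big[setI/setT]_(x in nodes S sigma) (X x @^-1` `]-oo, (- y (tag x))%R]).

Lemma deep_eventP (R : realType) (T : Type) (n : nat) (b : 'I_n -> nat)
    (L : finType) (S : L -> {set 'I_n}) (y : L -> R)
    (X : {l : L & subconfig b (S l)} -> T -> R) (sigma : config b) w :
  deep_event y X sigma w <-> (forall l, X (node S sigma l) w <= - y l).
Proof.
split=> [/bigsetIP h l|h].
  have := h (node S sigma l); rewrite /= in_itv/=; apply.
  by apply/imsetP; exists l.
by apply/bigsetIP => x /imsetP[l _ ->]; rewrite /= in_itv/=; exact: h.
Qed.

Lemma measurable_deep_event (R : realType) (d : measure_display)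
    (T : measurableType d) (P : probability T R)
    (n : nat) (b : 'I_n -> nat) (L : finType) (S : L -> {set 'I_n})
    (y : L -> R) (X : {l : L & subconfig b (S l)} -> {RV P >-> R})
    (sigma : config b) :
  measurable (deep_event y X sigma).
Proof.
apply: big_ind => //; first exact: measurableI.
by move=> x _; rewrite -[_ @^-1` _]setTI; exact: measurable_funP.
Qed.

Lemma prob_deep_eventI (R : realType) (d : measure_display)
    (T : measurableType d) (P : probability T R)
    (n : nat) (b : 'I_n -> nat) (L : finType) (S : L -> {set 'I_n})
    (y q : L -> R) (X : {l : L & subconfig b (S l)} -> {RV P >-> R})
    (sigma tau : config b) :
  mutually_independent X -> (forall l, 0 < q l) ->
  (forall x, P (X x @^-1` `]-oo, (- y (tag x))%R]) = (q (tag x))%:E) ->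
  P (deep_event y X sigma `&` deep_event y X tau) =
  ((\prod_l q l) ^+ 2
     * \prod_(l | S l \subset agreement sigma tau) (q l)^-1)%:E.
Proof.
move=> indX q0 hq.
have -> : deep_event y X sigma `&` deep_event y X tau =
    \big[setI/setT]_(x in nodes S sigma :|: nodes S tau)
      (X x @^-1` `]-oo, (- y (tag x))%R]).
  apply/seteqP; split=> w.
    move=> [/bigsetIP h1 /bigsetIP h2]; apply/bigsetIP => x.
    by rewrite finset.in_setU => /orP[/h1|/h2].
  move=> /bigsetIP h; split; apply/bigsetIP => x hx; apply: h.
    by rewrite finset.in_setU hx.
  by rewrite finset.in_setU hx orbT.
rewrite (indX _ (fun x => `]-oo, (- y (tag x))%R]%classic))//.
rewrite -prod_nodesU// -prodEFin; apply: eq_bigr => x _; exact: hq.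
Qed.

Lemma prob_deep_event (R : realType) (d : measure_display)
    (T : measurableType d) (P : probability T R)
    (n : nat) (b : 'I_n -> nat) (L : finType) (S : L -> {set 'I_n})
    (y q : L -> R) (X : {l : L & subconfig b (S l)} -> {RV P >-> R})
    (sigma : config b) :
  mutually_independent X -> (forall l, 0 < q l) ->
  (forall x, P (X x @^-1` `]-oo, (- y (tag x))%R]) = (q (tag x))%:E) ->
  P (deep_event y X sigma) = (\prod_l q l)%:E.
Proof.
move=> indX q0 hq.
rewrite -[deep_event y X sigma]setIid (prob_deep_eventI sigma sigma indX q0 hq).
congr EFin; rewrite [X in _ * X](eq_bigl xpredT); last first.
  by move=> l /=; apply/fintype.subsetP => i _; rewrite inE.
by rewrite prodfV expr2 mulfK// gt_eqF// prodr_gt0.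
Qed.

(** Pairs that share no node contribute nothing.  The other pairs are sorted by
    a nonempty set [A] on which they agree, and a fraction 2^(- b(A)) of all pairs
    agrees on [A]. *)
Lemma sum_pairs_agreement_le (R : realType) (n : nat) (b : 'I_n -> nat)
    (L : finType) (S : L -> {set 'I_n}) (q : L -> R) :
  (forall l, S l != finset.set0) -> (forall l, 0 < q l) ->
  \sum_(sigma : config b) \sum_(tau : config b)
    (\prod_(l | S l \subset agreement sigma tau) (q l)^-1 - 1)
  <= #|config b|%:R ^+ 2 *
     \sum_(A : {set 'I_n} | A != finset.set0)
       2 ^- (\sum_(i in A) b i) * \prod_(l | S l \subset A) (q l)^-1.
Proof.
move=> S0 q0.
pose g (A : {set 'I_n}) := \prod_(l | S l \subset A) (q l)^-1.
have g0 A : 0 < g A by apply: prodr_gt0 => l _; rewrite invr_gt0.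
apply: (@le_trans _ _ (\sum_(sigma : config b) \sum_(tau : config b)
   \sum_(A : {set 'I_n} | A != finset.set0) (agree A tau sigma)%:R * g A)).
  apply: ler_sum => sigma _; apply: ler_sum => tau _.
  rewrite -/(g _); have [A0|nA0] := eqVneq (agreement sigma tau) finset.set0.
    have -> : g (agreement sigma tau) = 1.
      by rewrite A0 /g big_pred0// => l; rewrite finset.subset0 (negbTE (S0 l)).
    by rewrite subrr; apply: sumr_ge0 => A _; rewrite mulr_ge0// (ltW (g0 A)).
  rewrite (bigD1 (agreement sigma tau))//=.
  have -> : agree (agreement sigma tau) tau sigma = true.
    by apply/agreeP => i; rewrite inE => /eqP ->.
  rewrite mul1r; apply: (@le_trans _ _ (g (agreement sigma tau))).
    by rewrite lerBlDr lerDl.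
  by rewrite lerDl; apply: sumr_ge0 => A _; rewrite mulr_ge0// (ltW (g0 A)).
under eq_bigr do rewrite exchange_big/=.
rewrite exchange_big/= mulr_sumr; apply: ler_sum => A _.
under eq_bigr => sigma _ do rewrite -mulr_suml.
rewrite -mulr_suml mulrA ler_pM2r; last exact: g0.
rewrite (eq_bigr (fun=> #|config b|%:R * 2 ^- (\sum_(i in A) b i))).
  by rewrite sumr_const -[leLHS]mulr_natl mulrA expr2.
move=> sigma _; rewrite -natr_sum -(card_agree A sigma) natrM natrX mulfK.
  rewrite -sum1_card; congr (_%:R); rewrite [RHS]big_mkcond/=.
  by apply: eq_bigr => tau _; rewrite inE; case: agree.
by rewrite expf_neq0.
Qed.

(** Chebyshev's inequality for the number of deep configurations.  The sum on
    the right is small when, for every nonempty [A], the 2^(b(A)) values of the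
    blocks in [A] outnumber the inverse of the probability that the levels inside
    [A] are deep. *)
Lemma deep_count_concentration (R : realType) (d : measure_display)
    (T : measurableType d) (P : probability T R)
    (n : nat) (b : 'I_n -> nat) (L : finType) (S : L -> {set 'I_n})
    (y q : L -> R) (X : {l : L & subconfig b (S l)} -> {RV P >-> R}) :
  mutually_independent X -> (forall l, S l != finset.set0) ->
  (forall l, 0 < q l) ->
  (forall x, P (X x @^-1` `]-oo, (- y (tag x))%R]) = (q (tag x))%:E) ->
  (P [set w | (\sum_(sigma : config b) \1_(deep_event y X sigma) w
       <= #|config b|%:R * (\prod_l q l) / 2)%R]
   <= (4 * \sum_(A : {set 'I_n} | A != finset.set0)
        2 ^- (\sum_(i in A) b i) * \prod_(l | S l \subset A) (q l)^-1)%:E)%E.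
Proof.
move=> indX S0 q0 hq.
pose ev := deep_event y X; pose Q := \prod_l q l.
have mev sigma : measurable (ev sigma) := measurable_deep_event y X sigma.
have Q0 : 0 < Q by apply: prodr_gt0.
have card0 : 0 < #|config b|%:R :> R.
  by rewrite ltr0n; apply/card_gt0P; exists [ffun i : 'I_n => [ffun=> true]].
pose m1 := #|config b|%:R * Q; have m1_gt0 : 0 < m1 by rewrite mulr_gt0.
pose cnt w : R := \sum_(sigma : config b) \1_(ev sigma) w.
have cnt0 w : 0 <= cnt w by apply: sumr_ge0.
have mcnt : measurable_fun setT cnt.
  by apply: measurable_sum_cond => sigma; exact: measurable_indic.
have Ecnt : (\int[P]_w (cnt w)%:E = m1%:E)%E.
  under eq_integral do rewrite -sumEFin.
  rewrite ge0_integral_sum//.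
  - rewrite (eq_bigr (fun=> Q%:E)).
      by rewrite sumEFin sumr_const -[in LHS]mulr_natl.
    move=> sigma _; rewrite integral_indic// setIT.
    exact: prob_deep_event.
  - by move=> sigma; apply/measurable_EFinP; exact: measurable_indic.
pose s2 := \sum_(sigma : config b) \sum_(tau : config b)
  Q ^+ 2 * \prod_(l | S l \subset agreement sigma tau) (q l)^-1.
have Ecnt2 : (\int[P]_w (cnt w ^+ 2)%:E = s2%:E)%E.
  transitivity (\int[P]_w (\sum_(sigma : config b) \sum_(tau : config b)
      (\1_(ev sigma `&` ev tau) w : R)%:E))%E.
    apply: eq_integral => w _; rewrite expr2 /cnt mulr_suml -sumEFin.
    apply: eq_bigr => sigma _; rewrite mulr_sumr -sumEFin.
    by apply: eq_bigr => tau _; rewrite indicI.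
  have mI sigma tau : measurable_fun setT (fun w => (\1_(ev sigma `&` ev tau) w : R)%:E).
    by apply/measurable_EFinP/measurable_indic; exact: measurableI.
  rewrite ge0_integral_sum//; last 2 first.
  - by move=> sigma; exact: emeasurable_sum.
  - by move=> sigma w _; apply: sume_ge0 => tau _; rewrite lee_fin.
  rewrite /s2 -sumEFin; apply: eq_bigr => sigma _.
  rewrite ge0_integral_sum// -sumEFin; apply: eq_bigr => tau _.
  rewrite integral_indic ?setIT//; last exact: measurableI.
  exact: prob_deep_eventI.
(* Expanding the square would involve a negative term; moving it to the left
   side keeps all the integrands nonnegative. *)
have Evar : (\int[P]_w ((cnt w - m1) ^+ 2)%:E = (s2 - m1 ^+ 2)%:E)%E.
  have mv : measurable_fun setT (fun w => ((cnt w - m1) ^+ 2)%:E).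
    apply/measurable_EFinP; apply: measurable_funX; exact: measurable_funB.
  have mc : measurable_fun setT (fun w => (cnt w)%:E) by exact/measurable_EFinP.
  have mc2 : measurable_fun setT (fun w => (cnt w ^+ 2)%:E).
    by apply/measurable_EFinP; exact: measurable_funX.
  have tm : 0 <= 2 * m1 by rewrite mulr_ge0// ltW.
  have E : (\int[P]_w ((cnt w - m1) ^+ 2)%:E + (2 * m1 * m1)%:E
      = s2%:E + (m1 ^+ 2)%:E)%E.
    transitivity (\int[P]_w (((cnt w - m1) ^+ 2)%:E + (2 * m1)%:E * (cnt w)%:E))%E.
      rewrite ge0_integralD//.
      + by rewrite ge0_integralZl_EFin ?Ecnt// => w _; rewrite lee_fin.
      + by move=> w _; rewrite lee_fin sqr_ge0.
      + by move=> w _; apply: mule_ge0; rewrite lee_fin.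
      + by apply: emeasurable_funM.
    transitivity (\int[P]_w ((cnt w ^+ 2)%:E + (m1 ^+ 2)%:E))%E.
      apply: eq_integral => w _; rewrite -EFinM -!EFinD; congr EFin; ring.
    rewrite ge0_integralD//.
    + by rewrite integral_cst//= probability_setT mule1 Ecnt2.
    + by move=> w _; rewrite lee_fin sqr_ge0.
    + by move=> w _; rewrite lee_fin sqr_ge0.
  have := E; case: (\int[P]_w ((cnt w - m1) ^+ 2)%:E)%E => [r||]//.
  rewrite -!EFinD => -[re]; congr EFin.
  lra.
have var_le : s2 - m1 ^+ 2 <= m1 ^+ 2 * (\sum_(A : {set 'I_n} | A != finset.set0)
        2 ^- (\sum_(i in A) b i) * \prod_(l | S l \subset A) (q l)^-1).
  have -> : s2 - m1 ^+ 2 = Q ^+ 2 *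
     \sum_(sigma : config b) \sum_(tau : config b)
      (\prod_(l | S l \subset agreement sigma tau) (q l)^-1 - 1).
    rewrite mulr_sumr /s2 -[X in _ - X](_ : \sum_(sigma : config b)
        \sum_(tau : config b) Q ^+ 2 = _); last first.
      rewrite /m1 exprMn !sumr_const -mulr_natl; ring.
    rewrite -sumrB; apply: eq_bigr => sigma _.
    rewrite mulr_sumr -sumrB; apply: eq_bigr => tau _; ring.
  rewrite /m1 exprMn -[leRHS]mulrA [leRHS]mulrCA ler_pM2l ?exprn_gt0//.
  exact: sum_pairs_agreement_le.
have mbad : measurable [set w | cnt w <= m1 / 2].
  have -> : [set w | cnt w <= m1 / 2] = setT `&` cnt @^-1` `]-oo, m1 / 2]%classic.
    by rewrite setTI; apply/seteqP; split=> w /=; rewrite in_itv.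
  exact: mcnt.
rewrite -/cnt -/m1 -/Q.
apply: le_trans (markov_bound (f := fun w => (cnt w - m1) ^+ 2)
  (K := s2 - m1 ^+ 2) (c := (m1 / 2) ^+ 2) mbad _ _ _ _ _) _.
- by apply: measurable_funX; exact: measurable_funB.
- by move=> w; exact: sqr_ge0.
- by rewrite exprn_gt0// divr_gt0.
- move=> w /= hw; rewrite -[leRHS]sqrrN opprB ler_pXn2r// ?nnegrE; lra.
- by rewrite Evar.
- rewrite lee_fin ler_pdivrMr ?exprn_gt0// ?divr_gt0//.
  apply: le_trans var_le _; rewrite le_eqVlt; apply/orP; left; apply/eqP.
  by field.
Qed.

(** * Almost sure lower bound *)

(** Keep only the deep configurations in the partition function; there are at
    least half as many as expected. *)
Lemma ln_partition_ge (R : realType) (T : Type) (n : nat) (b : 'I_n -> nat)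
    (N : nat) (beta : R) (L : finType) (S : L -> {set 'I_n}) (c y q : L -> R)
    (X : {l : L & subconfig b (S l)} -> T -> R) w :
  0 <= beta -> (forall l, 0 <= c l) -> (forall l, 0 < q l) ->
  #|config b|%:R * (\prod_l q l) / 2
     < \sum_(sigma : config b) \1_(deep_event y X sigma) w ->
  (\sum_i b i)%:R * ln 2 + \sum_l ln (q l) - ln 2
    + beta * (N%:R * \sum_l c l * y l)
  <= ln (\sum_(sigma : config b)
       expR (- beta * model_hamiltonian N c (fun x => X x w) sigma)).
Proof.
move=> beta0 c0 q0 hcnt.
have Q0 : 0 < \prod_l q l by apply: prodr_gt0.
have card0 : 0 < #|config b|%:R :> R by rewrite card_config ltr0n expn_gt0.
have lnQ : ln (\prod_l q l) = \sum_l ln (q l).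
  have -> : \prod_l q l = expR (\sum_l ln (q l)).
    by rewrite expR_sum; apply: eq_bigr => l _; rewrite lnK// posrE.
  by rewrite expRK.
have lnc : ln (#|config b|%:R : R) = (\sum_i b i)%:R * ln 2.
  by rewrite card_config natrX -powR_mulrn// ln_powR.
pose E := expR (beta * (N%:R * \sum_l c l * y l)).
have E0 : 0 < E by exact: expR_gt0.
have low : #|config b|%:R * (\prod_l q l) / 2 * E <= \sum_(sigma : config b)
       expR (- beta * model_hamiltonian N c (fun x => X x w) sigma).
  apply: (@le_trans _ _ (\sum_(sigma : config b)
      \1_(deep_event y X sigma) w * E)).
    by rewrite -mulr_suml ler_pM2r// ltW.
  apply: ler_sum => sigma _; rewrite indicE.
  have [/set_mem/deep_eventP h|_] := boolP (w \in deep_event y X sigma); last first.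
    by rewrite mul0r expR_ge0.
  rewrite mul1r ler_expR /model_hamiltonian mulNr -mulrN -mulrN.
  apply: ler_wpM2l => //; apply: ler_wpM2l => //.
  rewrite -sumrN; apply: ler_sum => l _; rewrite -mulrN.
  by apply: ler_wpM2l => //; rewrite lerNr; exact: h.
have m0 : 0 < #|config b|%:R * (\prod_l q l) / 2 by rewrite divr_gt0// mulr_gt0.
apply: (@le_trans _ _ (ln (#|config b|%:R * (\prod_l q l) / 2 * E))); last first.
  by rewrite ler_ln ?posrE ?mulr_gt0//; apply: lt_le_trans low; rewrite mulr_gt0.
rewrite lnM ?posrE// ln_div ?posrE ?mulr_gt0// lnM ?posrE// lnc lnQ /E expRK.
by [].
Qed.

Lemma finite_gap (R : realType) (I : finType) (g : I -> R) :
  (forall i, 0 < g i) -> exists2 e, 0 < e & forall i, e <= g i.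
Proof.
move=> g0; exists (\big[Num.min/1]_i g i); first by apply/bigmin_gtP; split.
by move=> i; exact: bigmin_le_cond.
Qed.

(** The slack between [y] and [z] absorbs the prefactor of the Gaussian tail,
    and the strict entropy inequalities make the failure probabilities decay
    exponentially. *)
Lemma ae_free_energy_ge_strict (R : realType) (d : measure_display)
    (T : measurableType d) (P : probability T R)
    (n : nat) (k : nat -> 'I_n -> nat) (p : 'I_n -> R) (beta : R)
    (L : finType) (S : L -> {set 'I_n}) (c y z : L -> R)
    (X : forall N, {l : L & subconfig (k N) (S l)} -> {RV P >-> R})
    (N0 : nat) (eps : R) :
  (forall l, S l != finset.set0) ->
  (forall i, (k N i)%:R / N%:R @[N --> \oo] --> p i) ->
  (forall N, (N0 <= N)%N -> iid_normal 0 N%:R^-1 (@X N)) ->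
  0 <= beta -> (forall l, 0 <= c l) ->
  (forall l, 0 <= y l) -> (forall l, y l < z l) ->
  (forall A : {set 'I_n}, A != finset.set0 ->
     \sum_(l | S l \subset A) z l ^+ 2 / 2 < \sum_(i in A) p i * ln 2) ->
  0 < eps ->
  {ae P, forall w, \forall N \near \oo,
     \sum_i p i * ln 2 - \sum_l z l ^+ 2 / 2 + beta * \sum_l c l * y l - eps
     <= free_energy N beta (model_hamiltonian N c (fun x => X N x w))}.
Proof.
move=> S0 hkp iidX beta0 c0 y0 yz hz eps0.
pose sigma0 N : config (k N) := [ffun i : 'I_n => [ffun=> true]].
pose q N l : R := fine (normal_prob 0 (Num.sqrt N%:R^-1) `]-oo, (- y l)]%classic).
have hq N : (N0 <= N)%N -> forall x : {l : L & subconfig (k N) (S l)},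
    P (X N x @^-1` `]-oo, (- y (tag x))%R]) = (q N (tag x))%:E.
  move=> hN x; have [_ /(_ x) nX] := iidX N hN.
  rewrite /q -nX// fineK//; exact: fin_num_measure.
have tail : \forall N \near \oo, forall l, expR (- (N%:R * (z l ^+ 2 / 2))) <= q N l.
  apply: filter_forall => l.
  have [N1 hN1] := normal_lower_tail_rate (y0 l) (yz l).
  exists (maxn N0 N1) => // N /=; rewrite geq_max => /andP[hN0 hNN1].
  have [_ nX] := iidX N hN0.
  have := hN1 N hNN1 _ _ P _ (nX (node S (sigma0 N) l)).
  by rewrite (hq N hN0 (node S (sigma0 N) l)) lee_fin.
(* At most half of the entropy gap of each of the finitely many sets A. *)
have [gam gam0 hgam] : exists2 gam, 0 < gam & forall A : {set 'I_n},
    A != finset.set0 ->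
    \sum_(l | S l \subset A) z l ^+ 2 / 2 + gam <= \sum_(i in A) p i * ln 2 - gam.
  pose g (A : {set 'I_n}) := if A == finset.set0 then 1 else
    (\sum_(i in A) p i * ln 2 - \sum_(l | S l \subset A) z l ^+ 2 / 2) / 2.
  have [|e e0 he] := @finite_gap _ _ g.
    by move=> A; rewrite /g; case: ifPn => // hA; rewrite divr_gt0// subr_gt0 hz.
  exists e => // A hA; have := he A; rewrite /g (negbTE hA); lra.
have kcvg (A : {set 'I_n}) : \sum_(i in A) (k N i)%:R / N%:R * ln 2 @[N --> \oo]
    --> \sum_(i in A) p i * ln 2.
  apply: cvg_big => //; first exact: add_continuous.
  by move=> i _; apply: cvgMl; exact: hkp.
have kgap : \forall N \near \oo, forall A : {set 'I_n},
    \sum_(i in A) p i * ln 2 - gam <= \sum_(i in A) (k N i)%:R / N%:R * ln 2.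
  apply: filter_forall => A.
  by move/cvgr_ge : (kcvg A); apply; rewrite ltrBlDr ltrDl.
pose good N w := #|config (k N)|%:R * (\prod_l q N l) / 2
     < \sum_(sigma : config (k N)) \1_(deep_event y (X N) sigma) w.
have aegood : {ae P, forall w, \forall N \near \oo, good N w}.
  have [N1 _ hN1] := tail; have [N2 _ hN2] := kgap.
  pose F N := [set w | (\sum_(sigma : config (k N)) \1_(deep_event y (X N) sigma) w
       <= #|config (k N)|%:R * (\prod_l q N l) / 2)].
  suff : {ae P, forall w, \forall N \near \oo, ~ F N w}.
    by apply: filterS => w; apply: filterS => N /negP; rewrite -ltNge.
  apply: (@ae_eventually_not _ _ _ _ F (4 * #|{set 'I_n}|%:R) gam
    (maxn (maxn N0 1) (maxn N1 N2))) => //.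
    move=> N; pose cnt w : R := \sum_(sigma : config (k N)) \1_(deep_event y (X N) sigma) w.
    have -> : F N = setT `&` cnt @^-1` `]-oo, #|config (k N)|%:R * (\prod_l q N l) / 2]%classic.
      by rewrite setTI; apply/seteqP; split=> w /=; rewrite in_itv.
    have mcnt : measurable_fun setT cnt; last exact: mcnt.
    apply: measurable_sum_cond => sigma; apply: measurable_indic.
    exact: measurable_deep_event.
  move=> N; rewrite !geq_max => /andP[/andP[hN0 N_gt0] /andP[hNN1 hNN2]].
  have NR : 0 < N%:R :> R by rewrite ltr0n.
  have tailN := hN1 N hNN1; have kgapN := hN2 N hNN2.
  have q0 l : 0 < q N l by apply: lt_le_trans (tailN l); exact: expR_gt0.
  have [indX _] := iidX N hN0.
  apply: (le_trans (deep_count_concentration indX S0 q0 (hq N hN0))).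
  rewrite lee_fin -mulrA ler_pM2l//.
  apply: (@le_trans _ _ (\sum_(A : {set 'I_n}) expR (- (gam * N%:R)))); last first.
    by rewrite sumr_const -[leLHS]mulr_natl.
  rewrite [leLHS]big_mkcond/=; apply: ler_sum => A _.
  case: ifPn => hA; last exact: expR_ge0.
  apply: (@le_trans _ _ (expR (- ((\sum_(i in A) k N i)%:R * ln 2)) *
      \prod_(l | S l \subset A) expR (N%:R * (z l ^+ 2 / 2)))).
    have e2 : expR (- ((\sum_(i in A) k N i)%:R * ln 2)) =
        2 ^- (\sum_(i in A) k N i) :> R.
      by rewrite expRN expRM_natl lnK ?posrE.
    rewrite e2; apply: ler_wpM2l; first by rewrite invr_ge0 exprn_ge0.
    apply: ler_prod => l _; rewrite invr_ge0 (ltW (q0 l))/=.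
    by rewrite -[leRHS]invrK -expRN lef_pV2 ?posrE ?expR_gt0.
  rewrite -expR_sum -expRD ler_expR.
  have e1 : (\sum_(i in A) k N i)%:R * ln 2 = N%:R *
      \sum_(i in A) (k N i)%:R / N%:R * ln 2 :> R.
    rewrite natr_sum mulr_suml mulr_sumr; apply: eq_bigr => i _.
    by field; rewrite gt_eqF.
  rewrite e1 -mulr_sumr.
  have := ler_wpM2l (ltW NR) (le_trans (hgam A hA) (kgapN A)).
  rewrite mulrDr [N%:R * gam]mulrC; lra.
have lcvg : \sum_i (k N i)%:R / N%:R * ln 2 - N%:R^-1 * ln 2 @[N --> \oo] -->
    \sum_i p i * ln 2 - 0 * ln 2.
  apply: cvgB.
    by apply: cvg_sumr => i; apply: cvgMl; exact: hkp.
  apply: cvgMl; apply/gtr0_cvgV0; last exact: cvgr_idn.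
  by exists 1%N => // N /=; rewrite ltr0n.
have lower : \forall N \near \oo, \sum_i p i * ln 2 - eps <=
   \sum_i (k N i)%:R / N%:R * ln 2 - N%:R^-1 * ln 2.
  by move/cvgr_ge : lcvg; apply; rewrite mul0r subr0 ltrBlDr ltrDl.
apply: filterS aegood => w hw; near=> N.
have N_gt0 : (0 < N)%N by near: N; exists 1%N.
have NR : 0 < N%:R :> R by rewrite ltr0n.
have tailN : forall l, expR (- (N%:R * (z l ^+ 2 / 2))) <= q N l by near: N.
have q0 l : 0 < q N l by apply: lt_le_trans (tailN l); exact: expR_gt0.
have goodN : good N w by near: N.
have lowerN : \sum_i p i * ln 2 - eps <=
   \sum_i (k N i)%:R / N%:R * ln 2 - N%:R^-1 * ln 2 by near: N.
have := ln_partition_ge N beta0 c0 q0 goodN.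
rewrite /free_energy => /(ler_wpM2l (ltW _ : 0 <= N%:R^-1)).
rewrite invr_gt0 => /(_ NR); apply: le_trans.
have lq : - \sum_l N%:R * (z l ^+ 2 / 2) <= \sum_l ln (q N l).
  rewrite -sumrN; apply: ler_sum => l _.
  by rewrite -[leLHS]expRK ler_ln ?posrE ?expR_gt0.
apply: (@le_trans _ _ (N%:R^-1 * ((\sum_i k N i)%:R * ln 2
   - \sum_l N%:R * (z l ^+ 2 / 2) - ln 2 + beta * (N%:R * \sum_l c l * y l)))).
  have e1 : (\sum_i k N i)%:R * ln 2 = N%:R *
      \sum_i (k N i)%:R / N%:R * ln 2 :> R.
    rewrite natr_sum mulr_suml mulr_sumr; apply: eq_bigr => i _.
    by field; rewrite gt_eqF.
  rewrite e1 -mulr_sumr.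
  have -> : forall a z' c' : R, N%:R^-1 * (N%:R * a - N%:R * z' - ln 2 + beta * (N%:R * c'))
     = (a - N%:R^-1 * ln 2) - z' + beta * c'.
    by move=> a z' c'; field; rewrite gt_eqF.
  lra.
rewrite ler_pM2l ?invr_gt0//; lra.
Unshelve. all: by end_near.
Qed.

(** The blocks in [A] have enough entropy for all the levels that they
    determine. *)
Definition feasible (R : realType) (n : nat) (p : 'I_n -> R) (L : finType)
    (S : L -> {set 'I_n}) (x : L -> R) : Prop :=
  (forall l, 0 <= x l) /\
  forall A : {set 'I_n},
    \sum_(l | S l \subset A) x l ^+ 2 / 2 <= \sum_(i in A) p i * ln 2.

Definition lower_rate (R : realType) (n : nat) (p : 'I_n -> R) (beta : R)
    (L : finType) (c x : L -> R) : R :=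
  \sum_i p i * ln 2 - \sum_l x l ^+ 2 / 2 + beta * \sum_l c l * x l.

(** The profile [x] is pushed into the interior of the constraints: take
    [y = (1 - eta) x] and [z = (1 - eta) x + eta * eta].  Since [z] is a convex
    combination of [x] and [eta], its square exceeds (1 - eta) x^2 by at most
    eta^3, while the constraints gain an amount of order eta. *)
Lemma ae_free_energy_ge (R : realType) (d : measure_display)
    (T : measurableType d) (P : probability T R)
    (n : nat) (k : nat -> 'I_n -> nat) (p : 'I_n -> R) (beta : R)
    (L : finType) (S : L -> {set 'I_n}) (c x : L -> R)
    (X : forall N, {l : L & subconfig (k N) (S l)} -> {RV P >-> R})
    (N0 : nat) (eps : R) :
  (forall l, S l != finset.set0) ->
  (forall i, 0 < p i) ->
  (forall i, (k N i)%:R / N%:R @[N --> \oo] --> p i) ->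
  (forall N, (N0 <= N)%N -> iid_normal 0 N%:R^-1 (@X N)) ->
  0 <= beta -> (forall l, 0 <= c l) ->
  feasible p S x -> 0 < eps ->
  {ae P, forall w, \forall N \near \oo,
     lower_rate p beta c x - eps
     <= free_energy N beta (model_hamiltonian N c (fun x => X N x w))}.
Proof.
move=> S0 p0 hkp iidX beta0 c0 [x0 hx] eps0.
have ln2 : 0 < ln 2 :> R by rewrite ln_gt0// ltr1n.
have [g0 g00 hg0] : exists2 g0, 0 < g0 & forall i, g0 <= p i * ln 2.
  by apply: finite_gap => i; rewrite mulr_gt0.
pose K := #|L|%:R : R; have K0 : 0 <= K by [].
pose B := beta * \sum_l c l * x l.
have B0 : 0 <= B by rewrite mulr_ge0// sumr_ge0// => l _; rewrite mulr_ge0.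
pose D := K + 1 + B; have D0 : 0 < D by rewrite /D; lra.
(* The total loss is at most eta * D. *)
pose eta := Num.min (2^-1) (Num.min g0 (eps / 2) / D).
have m0 : 0 < Num.min g0 (eps / 2) by rewrite lt_min g00 divr_gt0.
have eta0 : 0 < eta by rewrite lt_min invr_gt0 ltr0n divr_gt0.
have eta2 : eta <= 2^-1 by rewrite ge_min lexx.
have etaD : eta * D <= Num.min g0 (eps / 2).
  by rewrite -ler_pdivlMr// ge_min lexx orbT.
have etag : eta * D <= g0 by apply: le_trans etaD _; rewrite ge_min lexx.
have etae : eta * D <= eps / 2 by apply: le_trans etaD _; rewrite ge_min lexx orbT.
pose y l := (1 - eta) * x l; pose z l := y l + eta ^+ 2.
have e1 : 0 < 1 - eta by lra.
have ee : 0 < eta ^+ 2 by rewrite exprn_gt0.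
have ee1 : eta ^+ 2 <= 1 by rewrite expr_le1//; lra.
have zle l : z l ^+ 2 / 2 <= (1 - eta) * (x l ^+ 2 / 2) + eta * eta ^+ 2 / 2.
  have -> : (1 - eta) * (x l ^+ 2 / 2) + eta * eta ^+ 2 / 2 =
    z l ^+ 2 / 2 + (1 - eta) * eta * (x l - eta) ^+ 2 / 2 by rewrite /z /y; field.
  by rewrite lerDl divr_ge0// mulr_ge0 ?sqr_ge0// mulr_ge0// ltW.
have sumz (Q : pred L) : \sum_(l | Q l) z l ^+ 2 / 2 <=
    (1 - eta) * (\sum_(l | Q l) x l ^+ 2 / 2) + eta * (eta ^+ 2 * K / 2).
  apply: (@le_trans _ _ (\sum_(l | Q l) ((1 - eta) * (x l ^+ 2 / 2) + eta * eta ^+ 2 / 2))).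
    by apply: ler_sum => l _.
  rewrite big_split/= -mulr_sumr lerD2l.
  rewrite sumr_const -[leLHS]mulr_natr.
  have -> : eta * (eta ^+ 2 * K / 2) = eta * eta ^+ 2 / 2 * K by ring.
  apply: ler_wpM2l; first by rewrite divr_ge0// mulr_ge0 ?ltW.
  by rewrite /K ler_nat max_card.
have ekd : eta ^+ 2 * K / 2 <= eta * K.
  have : eta * eta * K <= eta * 1 * K.
    by rewrite ler_wpM2r// ler_wpM2l ?(ltW eta0)//; lra.
  have : 0 <= eta * K by rewrite mulr_ge0// ltW.
  rewrite expr2; lra.
have eB : 0 <= eta * B by rewrite mulr_ge0// ltW.
have eD : eta * D = eta * K + eta + eta * B by rewrite /D; ring.
have strict (A : {set 'I_n}) : A != finset.set0 ->
    \sum_(l | S l \subset A) z l ^+ 2 / 2 < \sum_(i in A) p i * ln 2.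
  move=> /set0Pn[i iA]; apply: (le_lt_trans (sumz _)).
  have gA : g0 <= \sum_(j in A) p j * ln 2.
    apply: (le_trans (hg0 i)); rewrite (bigD1 i)//= lerDl.
    by apply: sumr_ge0 => j _; rewrite mulr_ge0// ltW.
  have := ler_wpM2l (ltW e1) (hx A) => h1; apply: (le_lt_trans (lerD h1 (lexx _))).
  rewrite mulrBl mul1r -addrA gtrDl addrC subr_lt0 ltr_pM2l//.
  lra.
have := @ae_free_energy_ge_strict _ _ _ P _ k p beta L S c y z X N0 (eps / 2)
  S0 hkp iidX beta0 c0.
have y0 l : 0 <= y l by rewrite mulr_ge0// ltW.
have yz l : y l < z l by rewrite /z ltrDl.
move=> /(_ y0 yz strict); rewrite divr_gt0// => /(_ isT).
apply: filterS => w; apply: filterS => N; apply: le_trans.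
rewrite /lower_rate -/B.
have -> : beta * \sum_l c l * y l = (1 - eta) * B.
  rewrite /B mulrCA; congr (_ * _); rewrite mulr_sumr; apply: eq_bigr => l _.
  by rewrite /y; ring.
have := sumz xpredT.
have sx : 0 <= \sum_l x l ^+ 2 / 2.
  by apply: sumr_ge0 => l _; rewrite divr_ge0// sqr_ge0.
have : 0 <= eta * \sum_l x l ^+ 2 / 2 by rewrite mulr_ge0// ltW.
have : eta * (eta ^+ 2 * K / 2) <= eta * K.
  apply: le_trans ekd; rewrite ler_piMl//; last by lra.
  by rewrite divr_ge0// mulr_ge0// ltW.
rewrite !mulrBl !mul1r; lra.
Qed.

(** * The limiting free energy of the general model *)

(** With [x l = wmax M (S l) * beta * c l] the difference of the two rates is
    exactly the slackness term of [greedy_duality]. *)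
Lemma rate_duality (R : realType) (n : nat) (p : 'I_n -> R) (beta : R)
    (L : finType) (S : L -> {set 'I_n}) (c : L -> R) :
  (forall l, S l != finset.set0) -> (forall i, 0 < p i) ->
  0 <= beta -> (forall l, 0 <= c l) ->
  exists M : 'I_n -> R, exists x : L -> R,
    [/\ forall i, 0 < M i, forall i, M i <= 1, feasible p S x
      & lower_rate p beta c x = upper_rate p beta S c M].
Proof.
move=> S0 p0 beta0 c0.
have ln2 : 0 < ln 2 :> R by rewrite ln_gt0// ltr1n.
have f0 i : 0 < 2 * (p i * ln 2) by rewrite !mulr_gt0.
have C0 l : 0 <= beta ^+ 2 * c l ^+ 2 by rewrite mulr_ge0 ?sqr_ge0.
have hB (A : {set 'I_n}) : finset.set0 \subset A ->
    0 ^+ 2 * \sum_(l | (S l \subset A) && ~~ (S l \subset finset.set0)) (beta ^+ 2 * c l ^+ 2)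
    <= \sum_(i in A :\: finset.set0) 2 * (p i * ln 2).
  by move=> _; rewrite expr0n/= mul0r; apply: sumr_ge0 => i _; exact: ltW.
have [M [M1 M2 M3]] := greedy_duality f0 C0 (lexx 0) ler01 hB.
have nS l : (S l \subset finset.set0) = false by rewrite finset.subset0 (negbTE (S0 l)).
have n0 (i : 'I_n) : i \notin finset.set0 by rewrite finset.in_set0.
exists M, (fun l => wmax M (S l) * (beta * c l)); split.
- by move=> i; have [] := M1 i (n0 i).
- by move=> i; have [] := M1 i (n0 i).
- split=> [l|A]; first by rewrite mulr_ge0 ?wmax_ge0// mulr_ge0.
  have := M2 A (finset.sub0set _); rewrite finset.setD0 -mulr_sumr => h.
  rewrite -(ler_pM2l (x := 2))//; apply: le_trans h.
  rewrite mulr_sumr le_eqVlt; apply/orP; left; apply/eqP.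
  apply: eq_big => l; first by rewrite nS andbT.
  by move=> _; rewrite finset.setD0; field.
- rewrite /lower_rate /upper_rate.
  move: M3; rewrite finset.setC0.
  under eq_bigl do rewrite finset.in_setT.
  under [X in _ = X -> _]eq_bigl do rewrite nS.
  under [X in _ = X -> _]eq_bigr do rewrite finset.setD0.
  move=> M3.
  have e1 : \sum_i p i * ln 2 / M i = \sum_i p i * ln 2
      + 2^-1 * \sum_i 2 * (p i * ln 2) * ((M i)^-1 - 1).
    by rewrite mulr_sumr -big_split/=; apply: eq_bigr => i _; field;
      have [_ /gt_eqF -> _] := M1 i (n0 i).
  rewrite e1 M3 -addrA -[RHS]addrA; congr (_ + _).
  rewrite !mulr_sumr -sumrN -!big_split/=; apply: eq_bigr => l _.
  by field.
Qed.

Lemma ae_exists (R : realType) (d : measure_display)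
    (T : measurableType d) (P : probability T R) (Q : T -> Prop) :
  {ae P, forall w, Q w} -> exists w, Q w.
Proof.
move=> h; apply: (@filter_ex _ (almost_everywhere P)); last exact: h.
apply: ae_properfilter_algebraOfSetsType.
by apply: (@lt_le_trans _ _ 1%E); rewrite ?lte01// -(probability_setT P).
Qed.

Lemma almost_sure_limitP (R : realType) (d : measure_display)
    (T : measurableType d) (P : probability T R) (u : nat -> T -> R) (E : R) :
  (forall eps, 0 < eps -> {ae P, forall w, \forall N \near \oo, u N w <= E + eps}) ->
  (forall eps, 0 < eps -> {ae P, forall w, \forall N \near \oo, E - eps <= u N w}) ->
  almost_sure_limit P u E.
Proof.
move=> hu hl.
have h (q : nat) : {ae P, forall w, \forall N \near \oo,
    E - q.+1%:R^-1 <= u N w /\ u N w <= E + q.+1%:R^-1}.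
  have q0 : 0 < q.+1%:R^-1 :> R by rewrite invr_gt0.
  apply: filterS2 (hu _ q0) (hl _ q0) => w; apply: filterS2 => N; by split.
have := ae_foralln h; apply: filterS => w hw.
apply/cvgrPdist_le => e e0.
have [q qe] : exists q : nat, q.+1%:R^-1 <= e.
  exists (Num.truncn e^-1); rewrite -[leRHS]invrK lef_pV2 ?posrE ?invr_gt0//.
  exact/ltW/truncnS_gt.
have := hw q; apply: filterS => N [h1 h2].
move: h1 h2; move: (q.+1%:R^-1) qe => r re h1 h2.
by rewrite ler_norml; apply/andP; split; lra.
Qed.

Lemma almost_sure_limit_le (R : realType) (d : measure_display)
    (T : measurableType d) (P : probability T R) (u : nat -> T -> R) (E a : R) :
  almost_sure_limit P u E ->
  (forall eps, 0 < eps -> {ae P, forall w, \forall N \near \oo, u N w <= a + eps}) ->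
  E <= a.
Proof.
move=> hE ha; apply/ler_addgt0Pr => e e0.
have [w [h1 h2]] : exists w, (u N w @[N --> \oo] --> E) /\
    (\forall N \near \oo, u N w <= a + e).
  by apply: (@ae_exists _ _ _ P); apply: filterS2 hE (ha _ e0) => w; split.
rewrite -(cvg_lim _ h1)//; apply: limr_le => //; by apply/cvg_ex; exists E.
Qed.

Lemma almost_sure_limit_ge (R : realType) (d : measure_display)
    (T : measurableType d) (P : probability T R) (u : nat -> T -> R) (E a : R) :
  almost_sure_limit P u E ->
  (forall eps, 0 < eps -> {ae P, forall w, \forall N \near \oo, a - eps <= u N w}) ->
  a <= E.
Proof.
move=> hE ha; apply/ler_addgt0Pr => e e0; rewrite -lerBlDr.
have [w [h1 h2]] : exists w, (u N w @[N --> \oo] --> E) /\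
    (\forall N \near \oo, a - e <= u N w).
  by apply: (@ae_exists _ _ _ P); apply: filterS2 hE (ha _ e0) => w; split.
rewrite -(cvg_lim _ h1)//; apply: limr_ge => //; by apply/cvg_ex; exists E.
Qed.

Lemma model_free_energy (R : realType) (d : measure_display)
    (T : measurableType d) (P : probability T R)
    (n : nat) (k : nat -> 'I_n -> nat) (p : 'I_n -> R) (beta : R)
    (L : finType) (S : L -> {set 'I_n}) (c : L -> R)
    (X : forall N, {l : L & subconfig (k N) (S l)} -> {RV P >-> R})
    (N0 : nat) :
  (forall l, S l != finset.set0) -> (forall i, 0 < p i) ->
  (forall i, (k N i)%:R / N%:R @[N --> \oo] --> p i) ->
  (forall N, (N0 <= N)%N -> iid_normal 0 N%:R^-1 (@X N)) ->
  0 <= beta -> (forall l, 0 <= c l) ->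
  exists E : R,
    [/\ almost_sure_limit P (fun N w => free_energy N beta
          (model_hamiltonian N c (fun x => X N x w))) E,
        forall M, (forall i, 0 < M i) -> (forall i, M i <= 1) ->
          E <= upper_rate p beta S c M,
        forall x, feasible p S x -> lower_rate p beta c x <= E,
        exists M, [/\ forall i, 0 < M i, forall i, M i <= 1
          & E = upper_rate p beta S c M]
      & exists2 x, feasible p S x & E = lower_rate p beta c x].
Proof.
move=> S0 p0 hkp iidX beta0 c0.
have [M [x [M0 M1 hx E]]] := rate_duality S0 p0 beta0 c0.
have hlim : almost_sure_limit P (fun N w => free_energy N beta
    (model_hamiltonian N c (fun x => X N x w))) (upper_rate p beta S c M).
  apply: almost_sure_limitP => eps eps0.
    exact: (ae_free_energy_le beta c S0 hkp iidX).
  by rewrite -E; exact: (ae_free_energy_ge S0 p0 hkp iidX).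
exists (upper_rate p beta S c M); split => //.
- move=> M' M'0 M'1; apply: (almost_sure_limit_le hlim) => eps eps0.
  exact: (ae_free_energy_le beta c S0 hkp iidX).
- move=> x' hx'; apply: (almost_sure_limit_ge hlim) => eps eps0.
  exact: (ae_free_energy_ge S0 p0 hkp iidX).
- by exists M.
- by exists x.
Qed.

(** * Trees versus the Bolthausen-Kistler model *)

Lemma prefix_set0 (n : nat) (pi : {perm 'I_n}) : prefix_set pi 0 = finset.set0.
Proof. by apply/setP => i; rewrite finset.in_set0; apply/imsetP => -[j]; rewrite inE. Qed.

Lemma prefix_setT (n : nat) (pi : {perm 'I_n}) : prefix_set pi n = finset.setT.
Proof.
apply/setP => i; rewrite finset.in_setT; apply/imsetP.
by exists ((pi^-1)%g i); rewrite ?permKV// inE.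
Qed.

Lemma mem_prefix_set (n : nat) (pi : {perm 'I_n}) (j : 'I_n) (i : nat) :
  (pi j \in prefix_set pi i) = (j < i)%N.
Proof. by rewrite mem_imset ?inE//; exact: perm_inj. Qed.

Lemma prefix_set_sub (n : nat) (pi : {perm 'I_n}) (i : nat) :
  prefix_set pi i \subset prefix_set pi i.+1.
Proof. by apply: imsetS; apply/fintype.subsetP => j; rewrite !inE => /ltnW. Qed.

(** Every nonempty set enters the growing prefixes exactly once; the sum over
    the levels telescopes. *)
Lemma sum_levels (R : realType) (n : nat) (pi : {perm 'I_n})
    (g : nonempty_sets n -> R) :
  \sum_(i < n) \sum_(s : nonempty_sets n |
     (val s \subset prefix_set pi i.+1) && ~~ (val s \subset prefix_set pi i)) g s
  = \sum_s g s.
Proof.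
pose G (j : nat) := \sum_(s : nonempty_sets n | val s \subset prefix_set pi j) g s.
have step (i : nat) : \sum_(s : nonempty_sets n |
     (val s \subset prefix_set pi i.+1) && ~~ (val s \subset prefix_set pi i)) g s
    = G i.+1 - G i.
  rewrite /G [in RHS](bigID (fun s : nonempty_sets n => val s \subset prefix_set pi i))/=.
  rewrite [X in _ = X + _ - _](eq_bigl (fun s : nonempty_sets n => val s \subset prefix_set pi i)).
    by rewrite addrAC subrr add0r.
  move=> s; rewrite andbC andb_idr// => /fintype.subset_trans; apply.
  exact: prefix_set_sub.
rewrite (eq_bigr (fun i : 'I_n => G i.+1 - G i)); last by move=> i _; exact: step.
rewrite -(big_mkord xpredT (fun i => G i.+1 - G i)) telescope_sumr// {2}/G.
rewrite big_pred0 ?subr0; last first.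
  by move=> s; rewrite prefix_set0 finset.subset0; apply/negbTE; exact: (valP s).
by rewrite /G prefix_setT; apply: eq_bigl => s; rewrite finset.subsetT.
Qed.

Lemma cauchy_schwarz (R : realType) (I : finType) (Q : pred I) (a x : I -> R) :
  \sum_(i | Q i) a i * x i <=
  Num.sqrt (\sum_(i | Q i) a i ^+ 2) * Num.sqrt (\sum_(i | Q i) x i ^+ 2).
Proof.
set u2 := \sum_(i | Q i) a i ^+ 2; set v2 := \sum_(i | Q i) x i ^+ 2.
have u20 : 0 <= u2 by apply: sumr_ge0 => i _; exact: sqr_ge0.
have v20 : 0 <= v2 by apply: sumr_ge0 => i _; exact: sqr_ge0.
pose u := Num.sqrt u2; pose v := Num.sqrt v2.
have u_2 : u ^+ 2 = u2 by rewrite sqr_sqrtr.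
have v_2 : v ^+ 2 = v2 by rewrite sqr_sqrtr.
have u0 : 0 <= u by exact: sqrtr_ge0.
have v0 : 0 <= v by exact: sqrtr_ge0.
rewrite -/u -/v.
have [u00|un0] := eqVneq u 0.
  have a0 : forall i, Q i -> a i ^+ 2 = 0.
    apply/psumr_eq0P; last by rewrite -/u2 -u_2 u00 expr0n.
    by move=> i _; exact: sqr_ge0.
  rewrite u00 mul0r big1// => i Qi; have /eqP := a0 i Qi.
  by rewrite sqrf_eq0 => /eqP ->; rewrite mul0r.
have [v00|vn0] := eqVneq v 0.
  have x0' : forall i, Q i -> x i ^+ 2 = 0.
    apply/psumr_eq0P; last by rewrite -/v2 -v_2 v00 expr0n.
    by move=> i _; exact: sqr_ge0.
  rewrite v00 mulr0 big1// => i Qi; have /eqP := x0' i Qi.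
  by rewrite sqrf_eq0 => /eqP ->; rewrite mulr0.
have uv0 : 0 < 2 * (u * v) by rewrite !mulr_gt0// lt0r ?un0 ?vn0.
have : 0 <= \sum_(i | Q i) (a i * v - x i * u) ^+ 2.
  by apply: sumr_ge0 => i _; exact: sqr_ge0.
have -> : \sum_(i | Q i) (a i * v - x i * u) ^+ 2 =
    v ^+ 2 * u2 + u ^+ 2 * v2 - 2 * (u * v) * \sum_(i | Q i) a i * x i.
  rewrite !mulr_sumr -big_split/= -sumrB; apply: eq_bigr => i _; ring.
rewrite -u_2 -v_2 => h.
rewrite -(ler_pM2l uv0).
have -> : 2 * (u * v) * (u * v) = v ^+ 2 * u ^+ 2 + u ^+ 2 * v ^+ 2 by ring.
by rewrite -subr_ge0.
Qed.

Lemma perm_sorting (R : realType) (n : nat) (M : 'I_n -> R) :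
  exists pi : {perm 'I_n}, forall i j : 'I_n, (i <= j)%N -> M (pi i) <= M (pi j).
Proof.
pose leM := relpre M (<=%R : rel R).
have leM_tr : transitive leM by move=> a b c; exact: le_trans.
have leM_to : total leM by move=> a b; exact: le_total.
pose s := sort leM (enum 'I_n).
have ss : size s = n by rewrite size_sort size_enum_ord.
have : perm_eq s (ord_tuple n) by rewrite perm_sort val_ord_tuple.
move/tuple_permP => [pi spi]; exists pi => i j ij.
have nthE (l : 'I_n) : nth i s l = pi l.
  rewrite spi -(tnth_nth i [tuple tnth (ord_tuple n) (pi i0) | i0 < n] l).
  by rewrite tnth_mktuple tnth_ord_tuple.
have so : sorted leM s by exact: sort_sorted.
have := sorted_leq_nth leM_tr (fun a => lexx (M a)) i so.
move=> /(_ i j); rewrite !inE ss !ltn_ord => /(_ isT isT ij).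
by rewrite !nthE.
Qed.

Lemma tree_weight_sqr (R : realType) (n : nat) (a : nonempty_sets n -> R)
    (pi : {perm 'I_n}) (i : 'I_n) :
  tree_weight a pi i ^+ 2 = \sum_(s : nonempty_sets n |
     (val s \subset prefix_set pi i.+1) && ~~ (val s \subset prefix_set pi i)) a s ^+ 2.
Proof. by rewrite sqr_sqrtr// sumr_ge0// => s _; exact: sqr_ge0. Qed.

(** A set that enters with the i-th prefix contains the block [pi i], whose
    exponent is the largest so far when [pi] sorts [M]. *)
Lemma wmax_prefix (R : realType) (n : nat) (M : 'I_n -> R) (pi : {perm 'I_n})
    (i : 'I_n) (A : {set 'I_n}) :
  (forall j, 0 < M j) ->
  (forall i j : 'I_n, (i <= j)%N -> M (pi i) <= M (pi j)) ->
  A \subset prefix_set pi i.+1 -> ~~ (A \subset prefix_set pi i) ->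
  wmax M A = M (pi i).
Proof.
move=> M0 hpi AS /fintype.subsetPn[j jA jP].
have jE : j = pi i.
  have := fintype.subsetP AS _ jA; rewrite -(permKV pi j) in jP *.
  rewrite !mem_prefix_set in jP *; rewrite ltnS leq_eqVlt (negbTE jP) orbF.
  by move=> /eqP/val_inj ->.
apply: wmax_eq; [exact: ltW|by rewrite -jE|].
move=> l lA; have := fintype.subsetP AS _ lA; rewrite -(permKV pi l).
by rewrite mem_prefix_set ltnS => /hpi.
Qed.

Lemma upper_rate_tree (R : realType) (n : nat) (p : 'I_n -> R) (beta : R)
    (a : nonempty_sets n -> R) (M : 'I_n -> R) (pi : {perm 'I_n}) :
  (forall j, 0 < M j) ->
  (forall i j : 'I_n, (i <= j)%N -> M (pi i) <= M (pi j)) ->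
  upper_rate p beta (fun i : 'I_n => prefix_set pi i.+1) (tree_weight a pi) M
  = upper_rate p beta (fun s : nonempty_sets n => val s) a M.
Proof.
move=> M0 hpi; rewrite /upper_rate; congr (_ + _).
rewrite -(sum_levels pi); apply: eq_bigr => i _.
rewrite (wmax_prefix M0 hpi (A := prefix_set pi i.+1) (i := i))//; last first.
  by apply/fintype.subsetPn; exists (pi i); rewrite mem_prefix_set ?ltnn.
rewrite tree_weight_sqr mulr_sumr mulr_suml mulr_sumr; apply: eq_bigr => s /andP[s1 s2].
by rewrite (wmax_prefix M0 hpi s1 s2).
Qed.

(** Collapse [x] on each tree level to its Euclidean norm.  The weight of a
    tree level is the Euclidean norm of [a] there, so Cauchy-Schwarz compares the
    energies; the entropy constraint of [A] only involves prefixes inside [A],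
    hence only sets inside [A]. *)
Lemma lower_rate_tree (R : realType) (n : nat) (p : 'I_n -> R) (beta : R)
    (a x : nonempty_sets n -> R) (pi : {perm 'I_n}) :
  0 <= beta ->
  feasible p (fun s : nonempty_sets n => val s) x ->
  exists2 y, feasible p (fun i : 'I_n => prefix_set pi i.+1) y
    & lower_rate p beta a x <= lower_rate p beta (tree_weight a pi) y.
Proof.
move=> beta0 [x0 hx].
pose lev (i : 'I_n) (s : nonempty_sets n) :=
  (val s \subset prefix_set pi i.+1) && ~~ (val s \subset prefix_set pi i).
pose y i := Num.sqrt (\sum_(s | lev i s) x s ^+ 2).
have y2 i : y i ^+ 2 = \sum_(s | lev i s) x s ^+ 2.
  by rewrite sqr_sqrtr// sumr_ge0// => s _; exact: sqr_ge0.
exists y.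
  split=> [i|A]; first exact: sqrtr_ge0.
  apply: le_trans (hx A); rewrite [leRHS]big_mkcond/= -(sum_levels pi).
  rewrite big_mkcond/=; apply: ler_sum => i _; case: ifPn => iA.
    rewrite y2 mulr_suml; apply: ler_sum => s /andP[s1 _].
    by rewrite (fintype.subset_trans s1 iA).
  apply: sumr_ge0 => s _; case: ifP => // _.
  by rewrite divr_ge0// sqr_ge0.
rewrite /lower_rate; apply: lerD.
  rewrite lerD2l lerN2 -[leRHS](sum_levels pi); apply: ler_sum => i _.
  by rewrite y2 mulr_suml.
apply: ler_wpM2l => //; rewrite -[leLHS](sum_levels pi); apply: ler_sum => i _.
exact: cauchy_schwarz.
Qed.

Theorem theorem3p5p2 (R : realType) (n : nat)
    (k : nat -> 'I_n -> nat) (p : 'I_n -> R) (a : nonempty_sets n -> R)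
    (d : measure_display) (T : measurableType d) (P : probability T R)
    (xi : forall N : nat, bk_index (k N) -> {RV P >-> R})
    (eta : forall (pi : {perm 'I_n}) (N : nat),
       tree_node (k N) pi -> {RV P >-> R})
    (beta : R)
    (hk1 : forall N, (n <= N)%N -> forall i, (1 <= k N i)%N)
    (hksum : forall N, (n <= N)%N -> (\sum_(i < n) k N i)%N = N)
    (hp : forall i, 0 < p i)
    (hkp : forall i, (k N i)%:R / N%:R @[N --> \oo] --> p i)
    (ha : forall s, 0 <= a s)
    (hxi : forall N, (n <= N)%N -> iid_normal 0 N%:R^-1 (@xi N))
    (heta : forall (pi : {perm 'I_n}) N, (n <= N)%N ->
       iid_normal 0 N%:R^-1 (@eta pi N))
    (hbeta : 0 < beta) :
  exists (E : R) (Epi : {perm 'I_n} -> R),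
    [/\ almost_sure_limit P
          (fun N w => free_energy N beta
             (bk_hamiltonian N a (fun x => xi N x w))) E,
        forall pi : {perm 'I_n},
          almost_sure_limit P
            (fun N w => free_energy N beta
               (tree_hamiltonian N a (fun x => eta pi N x w))) (Epi pi)
      & E = inf (range Epi)].
Proof.
have [E [limE E_le _ [M [M0 M1 EM]] [x hx Ex]]] :=
  @model_free_energy _ _ _ P n k p beta _ (fun s : nonempty_sets n => val s) a
    xi n (fun s => valP s) hp hkp hxi (ltW hbeta) ha.
have prefix_neq0 (pi : {perm 'I_n}) (i : 'I_n) : prefix_set pi i.+1 != finset.set0.
  by apply/set0Pn; exists (pi i); rewrite mem_prefix_set.
have tree (pi : {perm 'I_n}) := @model_free_energy _ _ _ P n k p beta _
  (fun i : 'I_n => prefix_set pi i.+1) (tree_weight a pi) (eta pi) n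
  (prefix_neq0 pi) hp hkp (heta pi) (ltW hbeta) (fun i => sqrtr_ge0 _).
pose Epi pi := projT1 (cid (tree pi)).
have EpiP pi := projT2 (cid (tree pi)); rewrite -/(Epi _) in EpiP.
exists E, Epi; split=> // [pi|]; first by have [] := EpiP pi.
have E_lb pi : E <= Epi pi.
  have [y hy ley] := lower_rate_tree a pi (ltW hbeta) hx.
  have [_ _ ge_lower _ _] := EpiP pi.
  by rewrite Ex; apply: le_trans ley _; exact: ge_lower.
have [pi hpi] := perm_sorting M.
have Epi_le : Epi pi <= E.
  have [_ le_upper _ _ _] := EpiP pi.
  by rewrite EM -(upper_rate_tree _ _ _ M0 hpi); exact: le_upper.
apply/eqP; rewrite eq_le; apply/andP; split.
  by apply: lb_le_inf => [|_ [pi' _ <-]]; [exists (Epi pi), pi|exact: E_lb].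
apply: le_trans Epi_le; apply: ge_inf; last by exists pi.
by exists E => _ [pi' _ <-]; exact: E_lb.
Qed.
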